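(* For $V\in\{X,Y\}$ fix $m_V\in(2,\infty)$, $b_1^V,b_2^V\in(0,\infty)$, $\lambda_{1,V}'\in(1,\infty)$ and $\lambda_{2,V}'\in(0,\infty)$. There exists a constant $C$ depending only on $b_2^V,\lambda_{1,V}',\lambda_{2,V}'$ and $m_V$ for $V\in\{X,Y\}$ such that the following holds for all integers $n_X,n_Y>3$ and $d\ge2$, all $\overline\eta_X,\overline\eta_Y\in[0,1/2)$, and all data such that for each $V\in\{X,Y\}$ the $V$-sample follows the contamination model with parameters $(m_V,b_1^V,b_2^V,\overline\eta_V)$ (no independence between the two samples is assumed). If $$\max_{V\in\{X,Y\}}\left[2\varepsilon_V'+\frac{\log(d^2n_V)}{n_V}+\sqrt{\left(\frac{\log(d^2n_V)}{n_V}\right)^2+4\frac{\log(d^2n_V)}{n_V}\varepsilon_V'}\right]<1,$$ then $$\mathbb{P}\left(\max_{1\le j,k\le d}\left|\tilde\Sigma^\Delta_{j,k}-\Sigma^\Delta_{j,k}\right|>C\,\mathfrak{d}^\Delta\right)\le 24\cdot\frac{n_Y+n_X}{n_Xn_Y},$$ where either $\tilde\Sigma^\Delta$ is the non-pooled estimator and $\mathfrak{d}^\Delta=w_Y^2\mathfrak{d}^X_{n_X}+w_X^2\mathfrak{d}^Y_{n_Y}$, or $\Sigma^X=\Sigma^Y$, $\tilde\Sigma^\Delta$ is the pooled estimator, and $\mathfrak{d}^\Delta=w_X^2\mathfrak{d}^X_{n_X}+w_Y^2\mathfrak{d}^Y_{n_Y}$.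
   Context: Notation: $v^*_{1,j}\le\dots\le v^*_{n,j}$ denotes the non-decreasing rearrangement of $v_{1,j},\dots,v_{n,j}$. Contamination model for the $V$-sample, $V\in\{X,Y\}$, with parameters $(m_V,b_1^V,b_2^V,\overline\eta_V)$: $V_1,\dots,V_{n_V}$ are i.i.d. random vectors in $\mathbb{R}^d$ with $\mathbb{E}|V_{1,j}|^{m_V}<\infty$ for all $j$, mean $\mu^V$ and covariance matrix $\Sigma^V$; $\min_j(\mathbb{E}|V_{1,j}-\mu^V_j|^2)^{1/2}\ge b_1^V$ and $\max_j(\mathbb{E}|V_{1,j}-\mu_j^V|^{m_V})^{1/m_V}\le b_2^V$. Observed are only random vectors $\tilde V_1,\dots,\tilde V_{n_V}$ in $\mathbb{R}^d$ (arbitrarily dependent on $V_1,\dots,V_{n_V}$) with $|\{i:\tilde V_i\ne V_i\}|\le\overline\eta_Vn_V$, where $\overline\eta_V\in[0,1/2)$ is known and non-random. Winsorized covariance estimators: $\phi_{\alpha,\beta}(x)=\alpha$ if $x<\alpha$, $x$ if $x\in[\alpha,\beta]$, $\beta$ if $x>\beta$. For $V\in\{X,Y\}$ put $\varepsilon_V'=\lambda_{1,V}'\overline\eta_V+\lambda_{2,V}'\log(d^2n_V)/n_V$ and, for $\varepsilon_V'<1/2$, $\hat a^V_j=\tilde V^*_{\lceil\varepsilon_V'n_V\rceil,j}$, $\hat b^V_j=\tilde V^*_{\lfloor(1-\varepsilon_V')n_V\rfloor+1,j}$, $\tilde\mu^V_j=n_V^{-1}\sum_{i=1}^{n_V}\phi_{\hat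 a^V_j,\hat b^V_j}(\tilde V_{i,j})$, $$\tilde\Sigma^V_{j,k}=n_V^{-1}\sum_{i=1}^{n_V}[\phi_{\hat a^V_j,\hat b^V_j}(\tilde V_{i,j})-\tilde\mu^V_j][\phi_{\hat a^V_k,\hat b^V_k}(\tilde V_{i,k})-\tilde\mu^V_k],\qquad 1\le j,k\le d.$$ Let $w_X=\sqrt{n_X/(n_X+n_Y)}$, $w_Y=\sqrt{n_Y/(n_X+n_Y)}$, $\Sigma^\Delta=w_Y^2\Sigma^X+w_X^2\Sigma^Y$. The non-pooled estimator is $\tilde\Sigma^\Delta=w_Y^2\tilde\Sigma^X+w_X^2\tilde\Sigma^Y$; the pooled estimator is $\tilde\Sigma^\Delta=w_X^2\tilde\Sigma^X+w_Y^2\tilde\Sigma^Y$. Rates: $\mathfrak{d}^V_{n_V}=\overline\eta_V^{\,1-\frac2{m_V}}+\left(\frac{\log(dn_V)}{n_V}\right)^{1-\frac1{(m_V/2)\wedge2}}$ for $V\in\{X,Y\}$. *)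

(* Defs.v *)
From HB Require Import structures.
From mathcomp Require Import all_boot all_order all_algebra.
From mathcomp Require Import all_classical all_reals all_analysis.

Set Implicit Arguments.
Unset Strict Implicit.
Unset Printing Implicit Defensive.

Import Order.TTheory GRing.Theory Num.Theory.
Import numFieldNormedType.Exports.

Local Open Scope classical_set_scope.
Local Open Scope ring_scope.

(* Random vectors in R^d are random variables with values in [d.-tuple R],
   whose sigma-algebra (generated by the coordinates) is the Borel one. *)

Section samples.
Context {dT : measure_display} {T : measurableType dT} {R : realType}.
Variable P : probability T R.

Definition mutually_independent {dE} {E : measurableType dE} {n : nat}
    (V : 'I_n -> {RV P >-> E}) : Prop :=
  forall (J : {set 'I_n}) (A : 'I_n -> set E), (forall i, measurable (A i)) ->
    P (\bigcap_(i in [set` J]) (V i @^-1` A i)) =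
    (\prod_(i in J) P (V i @^-1` A i))%E.

Definition identically_distributed {dE} {E : measurableType dE} {n : nat}
    (V : 'I_n -> {RV P >-> E}) : Prop :=
  forall (i i' : 'I_n) (A : set E), measurable A ->
    distribution P (V i) A = distribution P (V i') A.

Definition iid {dE} {E : measurableType dE} {n : nat}
    (V : 'I_n -> {RV P >-> E}) : Prop :=
  mutually_independent V /\ identically_distributed V.

Definition vcoord {d n : nat} (V : 'I_n -> {RV P >-> d.-tuple R})
    (i : 'I_n) (j : 'I_d) : T -> R := fun w => tnth (V i w) j.

(* [V] is the uncontaminated sample, [V'] the observed one. Since the [V i] are
   identically distributed, the moment conditions on the first observation are
   required of every observation. *)
Record contamination_model {d n : nat} (m b1 b2 eta : R)
    (mu : 'I_d -> R) (Sigma : 'M[R]_d)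
    (V V' : 'I_n -> {RV P >-> d.-tuple R}) : Prop := {
  cm_iid : iid V ;
  cm_moment : forall i j,
    ('E_P[fun w => (`|vcoord V i j w| `^ m)%R] < +oo)%E ;
  cm_mean : forall i j, ('E_P[vcoord V i j] = (mu j)%:E)%E ;
  cm_cov : forall i j k,
    covariance P (vcoord V i j) (vcoord V i k) = (Sigma j k)%:E ;
  cm_lower : forall i j,
    (b1%:E <= 'N[P]_2%:E [EFin \o (fun w => vcoord V i j w - mu j)%R])%E ;
  cm_upper : forall i j,
    ('N[P]_m%:E [EFin \o (fun w => vcoord V i j w - mu j)%R] <= b2%:E)%E ;
  cm_contamination :
    {ae P, forall w, #|[set i | V' i w != V i w]%SET|%:R <= eta * n%:R}
}.

End samples.

Section estimators.
Context {R : realType}.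

(* The [k]-th smallest of the [v i], with ranks starting at 1. *)
Definition order_stat {n : nat} (v : 'I_n -> R) (k : nat) : R :=
  nth 0 (sort <=%R (codom v)) k.-1.

Definition winsorize (a b x : R) : R :=
  if x < a then a else if b < x then b else x.

Definition log_ratio (d n : nat) : R := ln (d ^ 2 * n)%:R / n%:R.

Definition eps_trim (l1 l2 eta : R) (d n : nat) : R :=
  l1 * eta + l2 * log_ratio d n.

(* For [0 < eps < 1/2] the two ranks below lie in {1, ..., n}. *)
Definition winsor_lo {n : nat} (eps : R) (v : 'I_n -> R) : R :=
  order_stat v `|Num.ceil (eps * n%:R)|%N.

Definition winsor_hi {n : nat} (eps : R) (v : 'I_n -> R) : R :=
  order_stat v (`|Num.floor ((1 - eps) * n%:R)|%N).+1.

Definition winsorized {n : nat} (eps : R) (v : 'I_n -> R) (i : 'I_n) : R :=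
  winsorize (winsor_lo eps v) (winsor_hi eps v) (v i).

Definition winsor_mean {n : nat} (eps : R) (v : 'I_n -> R) : R :=
  n%:R^-1 * \sum_(i < n) winsorized eps v i.

Definition winsor_cov {d n : nat} (eps : R) (x : 'I_n -> d.-tuple R) :
    'M[R]_d :=
  \matrix_(j < d, k < d)
    let xj := fun i => tnth (x i) j in
    let xk := fun i => tnth (x i) k in
    n%:R^-1 * \sum_(i < n) (winsorized eps xj i - winsor_mean eps xj) *
                           (winsorized eps xk i - winsor_mean eps xk).

Definition max_entry {d : nat} (A : 'M[R]_d) : R :=
  \big[Num.max/0]_(j < d) \big[Num.max/0]_(k < d) `|A j k|.

Definition weight (n n' : nat) : R := Num.sqrt (n%:R / (n + n')%:R).

Definition sample_size_term (eps : R) (d n : nat) : R :=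
  2 * eps + log_ratio d n +
  Num.sqrt (log_ratio d n ^+ 2 + 4 * log_ratio d n * eps).

Definition rate (m eta : R) (d n : nat) : R :=
  eta `^ (1 - 2 / m) +
  (ln (d * n)%:R / n%:R) `^ (1 - (Num.min (m / 2) 2)^-1).

End estimators.

(* Main.v *)
(* One sample, with L = log (d^2 n) / n and eps = eps': clamp the standardized
   observations at T = (c eps)^(-1/m). By Chernoff's bound fewer than
   (eps - eta) n uncontaminated values exceed T in a given coordinate, so both
   winsorization points lie within T standard units of the mean, and the
   winsorized observed values agree with the clamped uncontaminated ones except
   at 3 eps n indices; this costs O(eps T^2) = O(T^(2-m)). A second Chernoff
   bound gives averages of products of clamped values up to
   O(T^(2-m) + sqrt L + L T^2), where the m-th moments bound the second moment
   of such a product by O(1 + T^(4-m)). Everything is O(rate), each event fails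
   with probability at most 2 / (d^2 n), and w_X^2 + w_Y^2 = 1 combines the two
   samples by a union bound. *)

Require Import Defs.
From mathcomp Require Import all_boot all_order all_algebra.
From mathcomp Require Import all_classical all_reals all_analysis.
From mathcomp Require Import measurable_realfun ring lra.

Set Implicit Arguments.
Unset Strict Implicit.
Unset Printing Implicit Defensive.

Import Order.TTheory GRing.Theory Num.Theory.
Import numFieldNormedType.Exports.

Local Open Scope classical_set_scope.
Local Open Scope ring_scope.

(** Probability is spent on the uncontaminated observations alone, because the observed ones may
    depend on them arbitrarily; the passage to the observed sample is a deterministic count of
    indices. Standardizing divides by [b2], which makes all [m]-th absolute moments at most 1 and
    keeps the law of the sample out of the constants. The level T balances the costs: eps T^2 equals
    T^(2-m) / c, so wrong indices cost no more than the truncation bias up to a constant, and eps >=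
    l2' L keeps L T^2 of order L^(1-2/m). The exceedance count has to fit into the trimming margin
    eps - eta = (l1' - 1) eta + l2' L; [c] and the Chernoff parameter 2 / l2' are tuned so that the
    expected count and the deviation each take at most half of it. Independence is given for events
    only, so exponential moments are factorized by way of simple functions. The empirical means
    enter through a product of two errors, which is again of the order of the rate because each
    error is bounded. *)

Section independence.
Context {dT dE : measure_display} {T : measurableType dT}
  {E : measurableType dE} {R : realType}.
Variable P : probability T R.
Import HBNNSimple.

(** * Product formula for independent variables and the exponential Chernoff bound *)

Lemma integral_indicT (A : set T) :
  measurable A -> (\int[P]_w (\1_A w : R)%:E = P A)%E.
Proof. by move=> mA; rewrite integral_indic// setIT. Qed.

Lemma integral_comp_indic (V : {RV P >-> E}) (A : set E) :
  measurable A -> (\int[P]_w (\1_A (V w) : R)%:E = P (V @^-1` A))%E.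
Proof.
by move=> mA; rewrite -integral_indicT//; exact: measurable_funPTI.
Qed.

(** The ladder from indicators through simple functions to increasing limits. In its application [G]
    is the product of the remaining factors; its mean [g] is real so that multiplication by it
    commutes with limits. *)
Lemma integral_mul_comp (G : T -> R) (V : {RV P >-> E}) (g : R)
    (f : E -> R) :
  measurable_fun setT G -> (forall w, 0 <= G w) -> 0 <= g ->
  (forall A, measurable A ->
    (\int[P]_w (G w * \1_A (V w))%:E = g%:E * P (V @^-1` A))%E) ->
  measurable_fun setT f -> (forall x, 0 <= f x) ->
  (\int[P]_w (G w * f (V w))%:E = g%:E * \int[P]_w (f (V w))%:E)%E.
Proof.
move=> mG G0 g0 GA mf f0.
have mV := measurable_funP V.
have mfe : measurable_fun setT (EFin \o f) by exact/measurable_EFinP.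
pose h := nnsfun_approx measurableT mfe.
have mhV n : measurable_fun setT (fun w => h n (V w)).
  by apply: (measurableT_comp (f := h n)) => //; exact: measurable_funP.
have hf x : (h n x)%:E @[n --> \oo] --> (f x)%:E.
  by apply: cvg_nnsfun_approx => // y _; rewrite lee_fin.
have hnd x : {homo (fun n => h n x) : m n / (m <= n)%N >-> m <= n}.
  by move=> m n mn; exact/lefP/nd_nnsfun_approx.
have step n : (\int[P]_w (G w * h n (V w))%:E =
    g%:E * \int[P]_w (h n (V w))%:E)%E.
  have mI r : measurable (h n @^-1` [set r]) by exact: measurable_funPTI.
  have mIV r : measurable_fun setT (fun w => \1_(h n @^-1` [set r]) (V w) : R).
    exact: (measurableT_comp (f := \1_(h n @^-1` [set r]) : E -> R)).
  have r0 r w : 0 <= r * \1_(h n @^-1` [set r]) (V w).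
    exact: nnfun_muleindic_ge0.
  transitivity (\sum_(r \in range (h n)) (\int[P]_w
      (G w * (r * \1_(h n @^-1` [set r]) (V w)))%:E)%E).
    rewrite -ge0_integral_fsum//.
    - apply: eq_integral => w _; rewrite fimfunE EFinM -fsumEFin//.
      rewrite ge0_mule_fsumr//.
      by move=> r; rewrite lee_fin.
    - move=> r; apply/measurable_EFinP; apply: measurable_funM => //.
      exact: measurable_funM.
    - by move=> r w _; rewrite lee_fin mulr_ge0.
  transitivity (g%:E * (\sum_(r \in range (h n)) (\int[P]_w
      (r * \1_(h n @^-1` [set r]) (V w))%:E)))%E; last first.
    congr (_ * _)%E; rewrite -ge0_integral_fsum//.
    - by apply: eq_integral => w _; rewrite fimfunE -fsumEFin.
    - by move=> r; apply/measurable_EFinP; exact: measurable_funM.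
    - by move=> r w _; rewrite lee_fin.
  rewrite ge0_mule_fsumr//; last first.
    by move=> r; apply: integral_ge0 => w _; rewrite lee_fin.
  apply: eq_fsbigr => r; rewrite inE => -[x _ hxr].
  have r_ge0 : 0 <= r by rewrite -hxr.
  under eq_integral do rewrite mulrCA EFinM.
  rewrite ge0_integralZl_EFin//.
  - rewrite GA//.
    under [in RHS]eq_integral do rewrite EFinM.
    rewrite ge0_integralZl_EFin//; last first.
      by apply/measurable_EFinP.
    by rewrite integral_comp_indic// muleCA.
  - by move=> w _; rewrite lee_fin mulr_ge0.
  - by apply/measurable_EFinP; exact: measurable_funM.
have L : (\int[P]_w (G w * f (V w))%:E =
    limn (fun n => \int[P]_w (G w * h n (V w))%:E))%E.
  rewrite -monotone_convergence//.
  - apply: eq_integral => w _; apply/esym/cvg_lim => //.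
    under eq_fun do rewrite EFinM.
    by rewrite EFinM; apply: cvgeZl.
  - by move=> n; apply/measurable_EFinP; exact: measurable_funM.
  - by move=> n w _; rewrite lee_fin mulr_ge0.
  - by move=> w _ m n mn; rewrite lee_fin ler_wpM2l// hnd.
have cvgI : (\int[P]_w (h n (V w))%:E)%E @[n --> \oo]
    --> (\int[P]_w (f (V w))%:E)%E.
  have -> : (\int[P]_w (f (V w))%:E =
      \int[P]_w limn (fun n => (h n (V w))%:E))%E.
    by apply: eq_integral => w _; apply/esym/cvg_lim.
  apply: cvg_monotone_convergence => //.
  - by move=> n; exact/measurable_EFinP.
  - by move=> n w _; rewrite lee_fin.
  - by move=> w _ m n mn; rewrite lee_fin hnd.
by rewrite L; under eq_fun do rewrite step; apply/cvg_lim => //; exact: cvgeZl.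
Qed.

(** Independence speaks of events, so the indicators are traded for arbitrary functions one factor
    at a time. *)
Lemma integral_prod_comp (n : nat) (V : 'I_n -> {RV P >-> E})
    (h : 'I_n -> E -> R) :
  mutually_independent V ->
  (forall i, measurable_fun setT (h i)) -> (forall i x, 0 <= h i x) ->
  (forall i, (\int[P]_w (h i (V i w))%:E < +oo)%E) ->
  (\int[P]_w (\prod_(i < n) h i (V i w))%:E =
   \prod_(i < n) \int[P]_w (h i (V i w))%:E)%E.
Proof.
move=> indV.
(* [k] counts the leading factors that may be arbitrary while the others are still indicators. Case
   0 is the definition of independence, and [k = n] leaves no restriction. *)
suff H k : forall h : 'I_n -> E -> R,
    (forall i : 'I_n, (k <= i)%N -> exists2 A, measurable A & h i = \1_A) ->
    (forall i, measurable_fun setT (h i)) -> (forall i x, 0 <= h i x) ->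
    (forall i, (\int[P]_w (h i (V i w))%:E < +oo)%E) ->
    (\int[P]_w (\prod_(i < n) h i (V i w))%:E =
     \prod_(i < n) \int[P]_w (h i (V i w))%:E)%E.
  by apply: (H n) => i; rewrite leqNgt ltn_ord.
elim: k => {h} [h hI _ _ _|k IH h hI mh h0 hfin].
  have {hI} /choice[A hA] i : exists A, measurable A /\ h i = \1_A.
    by have [//|A ? ?] := hI i; exists A.
  have mA i : measurable (A i) by case: (hA i).
  have hE i : h i = \1_(A i) by case: (hA i).
  have mVA i : measurable (V i @^-1` A i) by exact: measurable_funPTI.
  transitivity (P (\bigcap_(i in [set` [set: 'I_n]%SET]) (V i @^-1` A i))).
    rewrite -integral_indicT//; last first.
      by apply: fin_bigcap_measurable => //; exact: finite_finset.
    apply: eq_integral => w _; congr EFin.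
    under eq_bigr do rewrite hE indicE.
    rewrite indicE; have [wA|wA] := boolP (w \in _).
      apply: big1 => i _; rewrite (_ : V i w \in A i)//.
      by move/set_mem: wA => /(_ i); rewrite /= finset.inE => /(_ isT) ?; exact/mem_set.
    have [i wAi] : exists i, V i w \notin A i.
      apply: contrapT => /forallNP wA'; move/negP: wA; apply.
      by apply/mem_set => i _ /=; apply/set_mem; apply/negPn/negP/wA'.
    by rewrite (bigD1 i)//= (negbTE wAi) mul0r.
  rewrite indV//; apply: eq_big => [i|i _]; first by rewrite finset.inE.
  by rewrite hE integral_comp_indic.
have [kn|kn] := ltnP k n; last first.
  by apply: IH => // i ki; have := leq_ltn_trans ki (ltn_ord i); rewrite ltnNge kn.
pose i0 := Ordinal kn.
have mV i : measurable_fun setT (fun w => h i (V i w)).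
  by apply: (measurableT_comp (mh i)).
have gf : (\prod_(i < n | i != i0) \int[P]_w (h i (V i w))%:E)%E \is a fin_num.
  rewrite prode_fin_num// => i _; rewrite ge0_fin_numE//.
  by apply: integral_ge0 => w _; rewrite lee_fin.
have fE (f : E -> R) w : \prod_(i < n) (if i == i0 then f else h i) (V i w) =
    \prod_(i < n | i != i0) h i (V i w) * f (V i0 w).
  rewrite (bigD1 i0)//= eqxx mulrC; congr (_ * _).
  by apply: eq_bigr => i /negbTE ->.
have IE (f : E -> R) :
    (\prod_(i < n) \int[P]_w ((if i == i0 then f else h i) (V i w))%:E =
     \prod_(i < n | i != i0) \int[P]_w (h i (V i w))%:E *
     \int[P]_w (f (V i0 w))%:E)%E.
  rewrite (bigD1 i0)//= eqxx muleC; congr (_ * _)%E.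
  by apply: eq_bigr => i /negbTE ->.
have hh i : (if i == i0 then h i0 else h i) = h i by case: eqP => // ->.
transitivity (\int[P]_w (\prod_(i < n | i != i0) h i (V i w) * h i0 (V i0 w))%:E)%E.
  by apply: eq_integral => w _; rewrite -fE; under [in RHS]eq_bigr do rewrite hh.
transitivity (\prod_(i < n | i != i0) \int[P]_w (h i (V i w))%:E *
     \int[P]_w (h i0 (V i0 w))%:E)%E; last first.
  by rewrite -IE; under eq_bigr do rewrite hh.
rewrite -(fineK gf); apply: integral_mul_comp => //.
- under eq_fun do rewrite big_mkcond/=.
  by apply: measurable_prod => i _; case: (i != i0).
- by move=> w; apply: prodr_ge0.
- by apply: fine_ge0; apply: prode_ge0 => i _; apply: integral_ge0 => w _; rewrite lee_fin.
(* With an indicator in place of factor [k], only [k] arbitrary factors are left, so the induction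
   hypothesis applies. *)
- move=> A mA; rewrite (fineK gf) -integral_comp_indic// -IE.
  under eq_integral do rewrite -fE.
  apply: (IH (fun i => if i == i0 then \1_A else h i)).
  + move=> i ki; case: eqP => [_|/eqP ii0]; first by exists A.
    by apply: hI; rewrite ltn_neqAle ki andbT eq_sym.
  + by move=> i; case: ifP.
  + by move=> i x; case: ifP.
  + move=> i; case: ifP => // _; rewrite integral_comp_indic//.
    by rewrite (le_lt_trans (probability_le1 _ _)) ?ltry//; exact: measurable_funPTI.
Qed.

(** Markov's inequality for the exponential of the sum, whose mean factorizes by independence. The
    Chernoff parameter is absorbed into [y]. *)
Lemma chernoff_bound (n : nat) (V : 'I_n -> {RV P >-> E})
    (y : 'I_n -> E -> R) (c a : R) :
  mutually_independent V -> (forall i, measurable_fun setT (y i)) ->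
  (forall i, (\int[P]_w (expR (y i (V i w)))%:E <= (expR c)%:E)%E) ->
  (P [set w | (n%:R * (c + a) <= \sum_(i < n) y i (V i w))%R] <=
   (expR (- (n%:R * a)))%:E)%E.
Proof.
move=> indV my yc.
have mS : measurable_fun setT (fun w => \sum_(i < n) y i (V i w)).
  by apply: measurable_sum => i; exact: (measurableT_comp (my i)).
set A := [set w | _].
have mA : measurable A.
  rewrite /A -[X in measurable X]setTI; exact: measurable_fun_le.
have : ((expR (n%:R * (c + a)))%:E * P A <= (expR (n%:R * c))%:E)%E.
  rewrite -integral_indicT//.
  rewrite -ge0_integralZl_EFin//; last first.
    by apply/measurable_EFinP.
  have -> : (expR (n%:R * c))%:E = (\prod_(i < n) (expR c)%:E)%E.
    by rewrite prodEFin prodr_const card_ord expRM_natl.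
  apply: (@le_trans _ _
      (\prod_(i < n) \int[P]_w (expR (y i (V i w)))%:E)%E); last first.
    have I0 i : (0 <= \int[P]_w (expR (y i (V i w)))%:E)%E.
      by apply: integral_ge0 => w _; rewrite lee_fin expR_ge0.
    (* Products of extended reals are monotone for nonnegative factors, so positivity is carried
       along in the induction. *)
    pose le0 (u v : \bar R) := (0 <= u)%E && (u <= v)%E.
    suff /andP[] : le0 (\prod_(i < n) \int[P]_w (expR (y i (V i w)))%:E)%E
      (\prod_(i < n) (expR c)%:E)%E by [].
    apply: (big_ind2 le0) => [|u1 v1 u2 v2|i _]; rewrite /le0 ?I0 ?yc//.
      by rewrite lexx lee01.
    by move=> /andP[? ?] /andP[? ?]; rewrite mule_ge0// lee_pmul.
  have mexp i : measurable_fun setT (fun x => expR (y i x)).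
    exact: measurableT_comp.
  rewrite -(@integral_prod_comp n V (fun i x => expR (y i x)))//; last first.
    by move=> i; rewrite (le_lt_trans (yc i)) ?ltry.
  apply: ge0_le_integral => //.
  - by under eq_fun do rewrite -EFinM; apply/measurable_EFinP; exact: measurable_funM.
  - apply/measurable_EFinP; apply: measurable_prod => i _.
    exact: (measurableT_comp (mexp i)).
  move=> w _; rewrite -EFinM lee_fin -expR_sum indicE.
  have [/set_mem wA|_] := boolP (w \in A); last by rewrite mulr0 expR_ge0.
  by rewrite mulr1 ler_expR.
rewrite muleC -lee_pdivlMr ?expR_gt0// => /le_trans; apply.
rewrite -EFinM lee_fin -expRN -expRD ler_expR; lra.
Qed.

End independence.

(** * Statements that hold off an exceptional event, and union bounds *)

Section high_probability.
Context {dT : measure_display} {T : measurableType dT} {R : realType}.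
Variable P : probability T R.

(* The exceptional set [B] is there because [Q] need not be measurable. *)
Definition whp (b : R) (Q : T -> Prop) : Prop :=
  exists B, [/\ measurable B, (P B <= b%:E)%E & forall w, ~ B w -> Q w].

Lemma whp_le (a b : R) (Q Q' : T -> Prop) :
  a <= b -> (forall w, Q w -> Q' w) -> whp a Q -> whp b Q'.
Proof.
move=> ab QQ' [B [mB PB BQ]]; exists B; split => //.
- by rewrite (le_trans PB)// lee_fin.
- by move=> w /BQ /QQ'.
Qed.

Lemma whp_and (a b : R) (Q Q' : T -> Prop) :
  whp a Q -> whp b Q' -> whp (a + b) (fun w => Q w /\ Q' w).
Proof.
move=> [A [mA PA AQ]] [B [mB PB BQ]]; exists (A `|` B); split.
- exact: measurableU.
- by rewrite (le_trans (measureU2 _ _ _))// EFinD leeD.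
- by move=> w /not_orP[/AQ ? /BQ ?].
Qed.

Lemma whp_all (I : finType) (b : R) (Q : I -> T -> Prop) :
  (forall i, whp b (Q i)) -> whp (#|I|%:R * b) (fun w => forall i, Q i w).
Proof.
move=> H.
suff K (s : seq I) : whp ((size s)%:R * b) (fun w => forall i, i \in s -> Q i w).
  rewrite cardE; apply: whp_le (K (enum I)) => // w Qw i.
  by apply: Qw; rewrite mem_enum.
elim: s => [|i s IH].
  exists set0; split => //; first by rewrite measure0 mul0r.
rewrite /= -natr1 mulrDl mul1r addrC; apply: whp_le (whp_and (H i) IH) => //.
move=> w [Qi Qs] k; rewrite inE => /predU1P[-> //|]; exact: Qs.
Qed.

Lemma whp_ae (Q : T -> Prop) : {ae P, forall w, Q w} -> whp 0 Q.
Proof.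
move=> [B [mB PB BQ]]; exists B; split => //; first by rewrite PB.
by move=> w /(contra_not (BQ w)) /contrapT.
Qed.

Lemma whp_not (b : R) (A : set T) :
  measurable A -> whp b (fun w => ~ A w) -> (P A <= b%:E)%E.
Proof.
move=> mA [B [mB PB BA]]; rewrite (le_trans _ PB)// le_measure ?inE//.
by move=> w Aw; apply: contrapT => /BA.
Qed.

End high_probability.

(** * Elementary inequalities for exponentials, powers and clamped values *)

Section real_inequalities.
Context {R : realType}.
Implicit Types (x y t m : R).

(** Inverting [expR (- x) >= 1 - x] gives [expR x <= (1 - x)^-1], and (1 - x) (1 + x + 2 x^2) = 1 +
    x^2 (1 - 2 x) is at least 1 for x <= 1/2. *)
Lemma expR_le1DxD2sqr x : `|x| <= 1 / 2 -> expR x <= 1 + x + 2 * x ^+ 2.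
Proof.
rewrite ler_norml => /andP[x1 x2].
have H := expR_ge1Dx (- x).
have p : 0 < 1 - x by lra.
have e : expR x <= (1 - x)^-1.
  rewrite -[expR x]invrK -expRN lef_pV2 ?posrE ?expR_gt0//; lra.
apply: (le_trans e); rewrite -[X in X <= _]mul1r ler_pdivrMr//; nra.
Qed.

Lemma norm_winsorize_le t x : 0 <= t -> `|winsorize (- t) t x| <= t.
Proof.
move=> t0; rewrite /winsorize ler_norml; case: ifPn => [_|]; first lra.
rewrite -leNgt => xt; case: ifPn => [_|]; first lra.
by rewrite -leNgt => ?; apply/andP.
Qed.

Lemma winsorize_id t x : `|x| <= t -> winsorize (- t) t x = x.
Proof.
by rewrite ler_norml /winsorize => /andP[xl xu]; rewrite !ltNge xl xu.
Qed.

(** Treats both signs at once: a product of clamped values becomes x y times a factor in [0, 1]. *)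
Lemma winsorize_scale t x : 0 <= t ->
  exists2 a, 0 <= a <= 1 & winsorize (- t) t x = a * x.
Proof.
move=> t0; rewrite /winsorize; case: ltP => [xt|xt].
  have xN : x < 0 by lra.
  exists (- t / x); last by field; lra.
  rewrite -mulrN1 -mulrA mulN1r -invrN mulr_ge0 ?invr_ge0//=; last by lra.
  rewrite ler_pdivrMr; lra.
case: ltP => [tx|tx]; last by exists 1; rewrite ?mul1r// lexx ler01.
exists (t / x); last by field; lra.
rewrite divr_ge0//=; last by lra.
rewrite ler_pdivrMr; lra.
Qed.

Lemma le_powR_tail m t x : 2 < m -> 0 < t -> t <= x ->
  x ^+ 2 <= t `^ (2 - m) * x `^ m.
Proof.
move=> m2 t0 tx; have x0 : 0 < x by lra.
have -> : x ^+ 2 = x `^ (2 - m) * x `^ m.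
  rewrite -powRD; last by rewrite (gt_eqF x0) implybT.
  by rewrite subrK powR_mulrn ?ltW.
rewrite ler_wpM2r ?powR_ge0//.
rewrite -[2 - m]opprB !powRN lef_pV2 ?posrE ?powR_gt0//.
by rewrite ge0_ler_powR ?nnegrE; lra.
Qed.

(** Write x^4 = x^(4-m) x^m. For m > 4 the first summand suffices because x >= 1, for m <= 4 the
    second because x <= t. *)
Lemma le_pow4_powR m t x : 2 < m -> 1 <= x -> x <= t ->
  x ^+ 4 <= x `^ m + t ^+ 2 * t `^ (2 - m) * x `^ m.
Proof.
move=> m2 x1 xt; have [x0 t0] : 0 < x /\ 0 < t by split; lra.
have tE : t ^+ 2 * t `^ (2 - m) = t `^ (4 - m).
  rewrite -powR_mulrn ?ltW// -powRD ?(gt_eqF t0) ?implybT//.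
  by congr (_ `^ _); lra.
have xE : x ^+ 4 = x `^ (4 - m) * x `^ m.
  rewrite -powR_mulrn ?ltW// -powRD ?(gt_eqF x0) ?implybT//.
  by congr (_ `^ _); lra.
have xm0 := powR_ge0 x m.
rewrite tE xE; have [m4|m4] := leP m 4.
  have : x `^ (4 - m) <= t `^ (4 - m) by rewrite ge0_ler_powR ?nnegrE; lra.
  by nra.
have : x `^ (4 - m) <= x `^ 0 by rewrite ler_powR//; lra.
have := powR_ge0 t (4 - m); rewrite powRr0; nra.
Qed.

Let maxn_spec x y : exists2 M, 0 <= M & [/\ `|x| <= M, `|y| <= M &
  forall m, M `^ m <= `|x| `^ m + `|y| `^ m].
Proof.
exists (Num.max `|x| `|y|); first by rewrite le_max normr_ge0.
split => [||m]; rewrite ?le_max ?lexx ?orbT//.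
by case: (leP `|x| `|y|) => _; rewrite ?lerDl ?lerDr powR_ge0.
Qed.

(** Clamping can change the product only if the larger absolute value M exceeds [t], and then |x y|
    <= M^2 <= t^(2-m) M^m. *)
Lemma winsorize_prod_bias m t x y : 2 < m -> 0 < t ->
  `|x * y - winsorize (- t) t x * winsorize (- t) t y| <=
  t `^ (2 - m) * (`|x| `^ m + `|y| `^ m).
Proof.
move=> m2 t0; have [M M0 [xM yM MS]] := maxn_spec x y.
have pt := powR_ge0 t (2 - m).
have [Mt|tM] := leP M t.
  rewrite !winsorize_id ?(le_trans _ Mt)// subrr normr0.
  by rewrite mulr_ge0 ?addr_ge0 ?powR_ge0.
have [a /andP[a0 a1] ->] := winsorize_scale x (ltW t0).
have [b /andP[b0 b1] ->] := winsorize_scale y (ltW t0).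
have -> : x * y - a * x * (b * y) = (1 - a * b) * (x * y) by ring.
have ab1 : a * b <= 1 by nra.
have ab0 : 0 <= a * b by nra.
rewrite normrM ger0_norm ?normrM; last by lra.
have xy : `|x| * `|y| <= M ^+ 2 by rewrite expr2 ler_pM.
have xy0 : 0 <= `|x| * `|y| by rewrite mulr_ge0.
have := le_powR_tail m2 t0 (ltW tM); have := MS m; nra.
Qed.

(** Let N be the larger clamped absolute value. The leading 1 covers N <= 1; otherwise 1 < N <= t
    and N^4 is controlled by N^m. *)
Lemma winsorize_prod_sqr m t x y : 2 < m -> 1 <= t ->
  (winsorize (- t) t x * winsorize (- t) t y) ^+ 2 <=
  1 + (1 + t ^+ 2 * t `^ (2 - m)) * (`|x| `^ m + `|y| `^ m).
Proof.
move=> m2 t1; have t0 : 0 < t by lra.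
set u := winsorize _ _ x; set v := winsorize _ _ y.
have [N N0 [uN vN [Nt NS]]] : exists2 N, 0 <= N & [/\ `|u| <= N, `|v| <= N &
    N <= t /\ N `^ m <= `|x| `^ m + `|y| `^ m].
  have [M M0 [xM yM MS]] := maxn_spec x y.
  have le_norm z : `|winsorize (- t) t z| <= `|z|.
    have [a /andP[a0 a1] ->] := winsorize_scale z (ltW t0).
    by rewrite normrM ger0_norm// ler_piMl.
  exists (Num.max `|u| `|v|); first by rewrite le_max normr_ge0.
  split; rewrite ?le_max ?lexx ?orbT//; split.
    by rewrite ge_max !norm_winsorize_le// ltW.
  apply: le_trans (MS m); apply: ge0_ler_powR.
  - by lra.
  - by rewrite nnegrE le_max normr_ge0.
  - by rewrite nnegrE.
  - by rewrite ge_max (le_trans (le_norm x))// (le_trans (le_norm y)).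
have pt := powR_ge0 t (2 - m).
have uv : `|u * v| <= N ^+ 2 by rewrite normrM expr2 ler_pM.
have uv4 : (u * v) ^+ 2 <= N ^+ 4.
  rewrite -(real_normK (num_real (u * v))) -[N ^+ 4]/(N ^+ (2 * 2)%N) exprM.
  by apply: lerXn2r; rewrite ?nnegrE ?exprn_ge0.
have S0 : 0 <= `|x| `^ m + `|y| `^ m by rewrite addr_ge0 ?powR_ge0.
have tt : 0 <= t ^+ 2 * t `^ (2 - m) by rewrite mulr_ge0// sqr_ge0.
apply: (le_trans uv4); have [N1|N1] := leP N 1.
  have : N ^+ 4 <= 1 by rewrite exprn_ile1.
  by nra.
have := le_pow4_powR m2 (ltW N1) Nt; nra.
Qed.

End real_inequalities.

(** * Exponentials of products of clamped values *)

Section winsorized_products.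
Context {R : realType}.
Variables (m t L : R).
Hypotheses (m2 : 2 < m) (t1 : 1 <= t) (L0 : 0 < L).

(** Chernoff parameter lambda. The term t^2 gives 2 lambda t^2 <= 1, which keeps the exponent in
    [-1/2, 1/2]; the other term gives 2 lambda <= sqrt L, which makes the second-order term
    affordable. The price of confidence, L / lambda, is still of the order of [dev_rate]. *)
Definition mgf_arg : R := (2 * (t ^+ 2 + (Num.sqrt L)^-1))^-1.

(* [t `^ (2 - m)] bounds the bias of truncation at [t], the other two terms
   the fluctuation of an average at confidence [expR (- (n * L))]. *)
Definition dev_rate : R := t `^ (2 - m) + Num.sqrt L + L * t ^+ 2.

Let q0 : 0 < Num.sqrt L. Proof. by rewrite sqrtr_gt0. Qed.
Let qV0 : 0 < (Num.sqrt L)^-1. Proof. by rewrite invr_gt0. Qed.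

Let den0 : 0 < 2 * (t ^+ 2 + (Num.sqrt L)^-1).
Proof.
have : 0 <= t ^+ 2 by exact: sqr_ge0.
by move: qV0; lra.
Qed.

Lemma mgf_arg_gt0 : 0 < mgf_arg.
Proof. by rewrite invr_gt0. Qed.

Let lamE : mgf_arg * (2 * (t ^+ 2 + (Num.sqrt L)^-1)) = 1.
Proof. by rewrite mulVf// gt_eqF. Qed.

Let lam0 := mgf_arg_gt0.

Let lam_t : 2 * mgf_arg * t ^+ 2 <= 1.
Proof.
have := mulr_gt0 lam0 qV0; have := lamE; lra.
Qed.

Let lam_q : 2 * mgf_arg <= Num.sqrt L.
Proof.
have t2 : 0 <= t ^+ 2 by rewrite sqr_ge0.
have : 2 * mgf_arg * (Num.sqrt L)^-1 <= 1.
  by have := mulr_ge0 (ltW lam0) t2; have := lamE; lra.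
by rewrite ler_pdivrMr// mul1r.
Qed.

Lemma div_mgf_arg : L / mgf_arg = 2 * L * t ^+ 2 + 2 * Num.sqrt L.
Proof.
rewrite /mgf_arg invrK -[in RHS](sqr_sqrtr (ltW L0)) -[in LHS](sqr_sqrtr (ltW L0)).
rewrite sqrtr_sqr ger0_norm ?sqrtr_ge0//; field; exact: lt0r_neq0.
Qed.

(** The bound is affine in x y, |x|^m and |y|^m, so it can be integrated with the available moments.
    The sign [s] serves the upper and the lower tail. *)
Lemma expR_winsorize_prod (s x y : R) : `|s| = 1 ->
  let d := mgf_arg * (2 * t `^ (2 - m) + Num.sqrt L) in
  expR (s * mgf_arg * (winsorize (- t) t x * winsorize (- t) t y)) <=
  (1 + mgf_arg * Num.sqrt L) + (s * mgf_arg) * (x * y) +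
  d * `|x| `^ m + d * `|y| `^ m.
Proof.
move=> s1 /=; have t0 : 0 < t := lt_le_trans ltr01 t1.
set c := winsorize _ _ x * _; set lam := mgf_arg.
have := winsorize_prod_bias x y m2 t0; have := winsorize_prod_sqr x y m2 t1.
rewrite -/c; set S := _ + _ `^ _ => csq cbias.
have S0 : 0 <= S by rewrite addr_ge0 ?powR_ge0.
set p := t `^ (2 - m) in csq cbias *; have p0 : 0 <= p by exact: powR_ge0.
have ct : `|c| <= t ^+ 2.
  by rewrite normrM expr2 ler_pM// norm_winsorize_le// ltW.
clearbody c; have small : `|s * lam * c| <= 1 / 2.
  rewrite 2!normrM s1 mul1r (ger0_norm (ltW lam0)) -/lam.
  by have := ler_wpM2l (ltW lam0) ct; move: lam_t; rewrite -/lam; lra.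
have s2 : s ^+ 2 = 1 by rewrite -real_normK ?num_real// s1 expr1n.
apply: (le_trans (expR_le1DxD2sqr small)).
have bias : s * lam * c <= s * lam * (x * y) + lam * p * S.
  have : `|s * (x * y - c)| <= p * S by rewrite normrM s1 mul1r.
  rewrite ler_norml => /andP[+ _] => /(ler_wpM2l (ltW lam0)); rewrite -/lam; lra.
(* One factor 2 lambda is traded for sqrt L, or for 1 where it comes with t^2. *)
have quad : 2 * (s * lam * c) ^+ 2 <=
    lam * Num.sqrt L + lam * (Num.sqrt L + p) * S.
  rewrite !exprMn s2 mul1r.
  apply: (@le_trans _ _ (2 * lam ^+ 2 * (1 + (1 + t ^+ 2 * p) * S))).
    by rewrite mulrA ler_wpM2l// mulr_ge0// sqr_ge0.
  have -> : 2 * lam ^+ 2 * (1 + (1 + t ^+ 2 * p) * S) =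
    lam * ((2 * lam) * (1 + S) + (2 * lam * t ^+ 2) * (p * S)) by ring.
  have -> : lam * Num.sqrt L + lam * (Num.sqrt L + p) * S =
    lam * (Num.sqrt L * (1 + S) + 1 * (p * S)) by ring.
  rewrite ler_wpM2l ?(ltW lam0)// lerD// ler_wpM2r// ?mulr_ge0//.
  by rewrite addr_ge0.
have -> : 1 + lam * Num.sqrt L + s * lam * (x * y) +
    lam * (2 * p + Num.sqrt L) * `|x| `^ m + lam * (2 * p + Num.sqrt L) * `|y| `^ m
  = 1 + lam * Num.sqrt L + s * lam * (x * y) + lam * (2 * p + Num.sqrt L) * S.
  by rewrite /S; ring.
lra.
Qed.

End winsorized_products.

(** * Integrability and exponential moments *)

Section moments.
Context {dT : measure_display} {T : measurableType dT} {R : realType}.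
Variable P : probability T R.
Variables (m : R) (U W : T -> R).
Hypotheses (m2 : 2 < m) (mU : measurable_fun setT U) (mW : measurable_fun setT W).
Hypotheses (Um : (\int[P]_w (`|U w| `^ m)%:E <= 1)%E)
  (Wm : (\int[P]_w (`|W w| `^ m)%:E <= 1)%E).

Lemma measurable_norm_powR (f : T -> R) :
  measurable_fun setT f -> measurable_fun setT (fun w => `|f w| `^ m).
Proof.
move=> mf; apply: (measurableT_comp (measurable_powR m)).
exact: (measurableT_comp _ mf).
Qed.

Lemma integrable_norm_powR (f : T -> R) : measurable_fun setT f ->
  (\int[P]_w (`|f w| `^ m)%:E <= 1)%E ->
  P.-integrable setT (EFin \o (fun w => `|f w| `^ m)).
Proof.
move=> mf f1; apply/integrableP; split.
  exact/measurable_EFinP/measurable_norm_powR.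
under eq_integral do rewrite /= ger0_norm ?powR_ge0//.
by rewrite (le_lt_trans f1)// ltry.
Qed.

Lemma integrable_cstR (a : R) : P.-integrable setT (EFin \o (fun=> a)).
Proof.
exact: finite_measure_integrable_cst.
Qed.

Lemma integrable_prod : P.-integrable setT (EFin \o (fun w => U w * W w)).
Proof.
pose b w := 1 + `|U w| `^ m + (1 + `|W w| `^ m).
apply: (@le_integrable _ _ _ _ _ measurableT _ (EFin \o b)) => //.
- by apply/measurable_EFinP; exact: measurable_funM.
- move=> w _; rewrite lee_fin [in X in _ <= X]ger0_norm; last first.
    by rewrite !addr_ge0 ?powR_ge0.
  have sq (x : R) : `|x| ^+ 2 <= 1 + `|x| `^ m.
    have [x1|x1] := leP 1 `|x|.
      have := le_powR_tail m2 ltr01 x1; rewrite powR1; lra.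
    have := powR_ge0 `|x| m; have : `|x| ^+ 2 <= 1 by rewrite expr_le1// ltW.
    lra.
  rewrite normrM /b; have := sq (U w); have := sq (W w); nra.
- apply: (@integrableD _ _ _ _ _ measurableT (EFin \o (fun w => 1 + `|U w| `^ m))
    (EFin \o (fun w => 1 + `|W w| `^ m))).
    by apply: (@integrableD _ _ _ _ _ measurableT (EFin \o fun=> 1)
      (EFin \o (fun w => `|U w| `^ m)));
      [exact: integrable_cstR|exact: integrable_norm_powR].
  by apply: (@integrableD _ _ _ _ _ measurableT (EFin \o fun=> 1)
      (EFin \o (fun w => `|W w| `^ m)));
      [exact: integrable_cstR|exact: integrable_norm_powR].
Qed.

Variables (t L rho : R).
Hypotheses (t1 : 1 <= t) (L0 : 0 < L).
Hypothesis UW : (\int[P]_w (U w * W w)%:E = rho%:E)%E.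

Lemma measurable_winsorize (a b : R) : measurable_fun setT (@winsorize R a b).
Proof.
apply: measurable_fun_ifT => //; last apply: measurable_fun_ifT => //.
- by apply: measurable_fun_ltr.
- by apply: measurable_fun_ltr.
Qed.

(** Integrating the pointwise bound replaces both [m]-th moments by 1 and leaves 1 + lambda (s rho +
    4 t^(2-m) + 3 sqrt L), which lies below the exponential by 1 + x <= exp x. *)
Lemma mgf_winsorize_prod (s : R) : `|s| = 1 ->
  (\int[P]_w (expR (s * mgf_arg t L *
     (winsorize (- t) t (U w) * winsorize (- t) t (W w))))%:E <=
   (expR (mgf_arg t L * (s * rho + 5 * t `^ (2 - m) + 3 * Num.sqrt L)))%:E)%E.
Proof.
move=> s1; have t0 : 0 < t := lt_le_trans ltr01 t1.
set lam := mgf_arg t L; have lam0 : 0 < lam by exact: mgf_arg_gt0.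
pose p := t `^ (2 - m); have p0 : 0 <= p by exact: powR_ge0.
pose q := Num.sqrt L; have q0 : 0 <= q by exact: sqrtr_ge0.
pose d := lam * (2 * p + q).
have d0 : 0 <= d by rewrite mulr_ge0 ?(ltW lam0)// addr_ge0// mulr_ge0.
have iU := integrable_norm_powR mU Um; have iW := integrable_norm_powR mW Wm.
have i1 : P.-integrable setT (fun w => (1 + lam * q)%:E + (s * lam)%:E * (U w * W w)%:E)%E.
  apply: integrableD => //; first exact: integrable_cstR.
  exact/integrableZl/integrable_prod.
have i2 : P.-integrable setT (fun w => d%:E * (`|U w| `^ m)%:E)%E.
  exact: integrableZl.
have i3 : P.-integrable setT (fun w => d%:E * (`|W w| `^ m)%:E)%E.
  exact: integrableZl.
apply: (@le_trans _ _ (\int[P]_w ((1 + lam * q)%:E + (s * lam)%:E * (U w * W w)%:E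
    + d%:E * (`|U w| `^ m)%:E + d%:E * (`|W w| `^ m)%:E))%E).
  apply: ge0_le_integral => //.
  - apply/measurable_EFinP; apply: measurableT_comp => //.
    apply: measurable_funM => //; apply: measurable_funM.
      exact: (measurableT_comp (measurable_winsorize _ _)).
    exact: (measurableT_comp (measurable_winsorize _ _)).
  - by apply: (measurable_int P); apply: integrableD => //; exact: integrableD.
  - by move=> w _; rewrite -!EFinM -!EFinD lee_fin; exact: expR_winsorize_prod.
rewrite integralD//; last exact: integrableD.
rewrite integralD// integralD//; last 2 first.
- exact: integrable_cstR.
- exact/integrableZl/integrable_prod.
rewrite !integralZl//; last exact: integrable_prod.
have -> : (\int[P]_w (1 + lam * q)%:E = (1 + lam * q)%:E)%E.
  by have := expectation_cst P (1 + lam * q); rewrite unlock.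
rewrite UW.
apply: (@le_trans _ _ ((1 + lam * q)%:E + (s * lam)%:E * rho%:E + d%:E * 1 + d%:E * 1)%E).
  by rewrite !leeD// lee_wpmul2l// lee_fin.
rewrite !mule1 -!EFinM -!EFinD lee_fin.
apply: le_trans (expR_ge1Dx _); rewrite /d -/p -/q.
have := mulr_ge0 (ltW lam0) p0; lra.
Qed.

End moments.

(** * Concentration of averages of clamped products *)

Section concentration.
Context {dT dE : measure_display} {T : measurableType dT}
  {E : measurableType dE} {R : realType}.
Variable P : probability T R.

(** Chernoff's bound for both signs, divided by lambda. It serves second moments, and also means
    when [g] is the constant 1. *)
Lemma winsorize_prod_concentration (n : nat) (V : 'I_n -> {RV P >-> E})
    (m t L rho : R) (f g : E -> R) :
  (0 < n)%N -> 2 < m -> 1 <= t -> 0 < L -> mutually_independent V ->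
  measurable_fun setT f -> measurable_fun setT g ->
  (forall i, (\int[P]_w (`|f (V i w)| `^ m)%:E <= 1)%E) ->
  (forall i, (\int[P]_w (`|g (V i w)| `^ m)%:E <= 1)%E) ->
  (forall i, (\int[P]_w (f (V i w) * g (V i w))%:E = rho%:E)%E) ->
  whp P (2 * expR (- (n%:R * L)))
    (fun w => `|n%:R^-1 * (\sum_(i < n) winsorize (- t) t (f (V i w)) *
        winsorize (- t) t (g (V i w))) - rho| <= 5 * dev_rate m t L).
Proof.
move=> n0 m2 t1 L0 indV mf mg fm gm fg.
have t0 : 0 < t by lra.
set lam := mgf_arg t L; have lam0 : 0 < lam by exact: mgf_arg_gt0.
pose y s (x : E) := s * lam * (winsorize (- t) t (f x) * winsorize (- t) t (g x)).
pose c s := lam * (s * rho + 5 * t `^ (2 - m) + 3 * Num.sqrt L).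
have mwin (h : E -> R) : measurable_fun setT h ->
    measurable_fun setT (fun x => winsorize (- t) t (h x)).
  by move=> mh; exact: (measurableT_comp (measurable_winsorize _ _)).
have my s : measurable_fun setT (y s).
  apply: measurable_funM => //; apply: measurable_funM; exact: mwin.
have H s : `|s| = 1 -> whp P (expR (- (n%:R * L)))
    (fun w => ~ (n%:R * (c s + L) <= \sum_(i < n) y s (V i w))).
  move=> s1; exists [set w | n%:R * (c s + L) <= \sum_(i < n) y s (V i w)].
  split => //.
    rewrite -[X in measurable X]setTI; apply: measurable_fun_le => //.
    by apply: measurable_sum => i; exact: (measurableT_comp (my s)).
  apply: (@chernoff_bound _ _ _ _ _ _ n V (fun=> y s)) => // i.
  apply: mgf_winsorize_prod => //.
  - exact: (measurableT_comp mf).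
  - exact: (measurableT_comp mg).
have n1 : `|1 : R| = 1 by rewrite normr1.
have nN1 : `|- 1 : R| = 1 by rewrite normrN1.
apply: whp_le (whp_and (H _ n1) (H _ nN1)); first by rewrite mulr2n mulrDl mul1r.
move=> w [/negP + /negP]; rewrite -!ltNge.
have nR : 0 < n%:R :> R by rewrite ltr0n.
set Z := \sum_(i < n) _ * _.
have yE s : \sum_(i < n) y s (V i w) = s * lam * Z by rewrite mulr_sumr.
have key s : s * lam * Z < n%:R * (c s + L) ->
    s * (n%:R^-1 * Z - rho) <= 5 * dev_rate m t L.
  move=> h.
  (* [L / lam] equals 2 L t^2 + 2 sqrt L, which raises the coefficient of sqrt L from 3 to 5; hence
     the factor 5 in front of [dev_rate]. *)
  have {}h : s * (n%:R^-1 * Z) < s * rho + 5 * t `^ (2 - m) + 3 * Num.sqrt L + L / lam.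
    rewrite -(ltr_pM2l lam0) -(ltr_pM2l nR).
    have -> : n%:R * (lam * (s * (n%:R^-1 * Z))) = s * lam * Z.
      move: nR; move: (n%:R : R) => nu nu0; field; by rewrite gt_eqF.
    by rewrite mulrDr (mulrCA lam L) divff ?gt_eqF// mulr1.
  have Lt : 0 <= L * t ^+ 2 by rewrite mulr_ge0 ?sqr_ge0// ltW.
  by move: h; rewrite div_mgf_arg// /dev_rate; lra.
rewrite !yE => /key h1 /key hN1; rewrite ler_norml; apply/andP; split; lra.
Qed.

End concentration.

(** * Number of large observations *)

Section counts.
Context {dT dE : measure_display} {T : measurableType dT}
  {E : measurableType dE} {R : realType}.
Variable P : probability T R.

Lemma natr_card_sum (n : nat) (p : pred 'I_n) :
  #|[set i | p i]%SET|%:R = \sum_(i < n) (p i)%:R :> R.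
Proof.
rewrite -sum1_card natr_sum big_mkcond/=; apply: eq_bigr => i _.
by rewrite inE; case: (p i).
Qed.

(** The indicator of t < |x| is at most t^(-m) |x|^m, so its exponential moment is at most 1 + (expR
    lam - 1) t^(-m). The parameter [lam] stays free, to be tuned to the trimming level. *)
Lemma exceedance_concentration (n : nat) (V : 'I_n -> {RV P >-> E})
    (m t L lam : R) (f : E -> R) :
  0 < m -> 0 < t -> 0 < lam -> mutually_independent V ->
  measurable_fun setT f ->
  (forall i, (\int[P]_w (`|f (V i w)| `^ m)%:E <= 1)%E) ->
  whp P (expR (- (n%:R * L)))
    (fun w => lam * #|[set i | t < `|f (V i w)|]%SET|%:R <
              n%:R * ((expR lam - 1) * t `^ (- m) + L)).
Proof.
move=> m0 t0 lam0 indV mf fm.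
pose y (x : E) : R := lam * (t < `|f x|)%R%:R.
have my : measurable_fun setT y.
  apply: measurable_funM => //; rewrite (_ : (fun x => _) =
    (fun x => if t < `|f x| then 1 else 0 : R)); last first.
    by apply/funext => x; case: ifP.
  apply: measurable_fun_ifT => //; apply: measurable_fun_ltr => //.
  exact: (measurableT_comp _ mf).
have tm0 : 0 <= t `^ (- m) by exact: powR_ge0.
have e0 : 0 < expR lam - 1 by rewrite subr_gt0 expR_gt1.
pose B := [set w | n%:R * ((expR lam - 1) * t `^ (- m) + L) <=
  \sum_(i < n) y (V i w)].
exists B; split.
- rewrite /B -[X in measurable X]setTI; apply: measurable_fun_le => //.
  by apply: measurable_sum => i; exact: (measurableT_comp my).
- apply: (@chernoff_bound _ _ _ _ _ _ n V (fun=> y)) => // i.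
  have mU : measurable_fun setT (fun w => `|f (V i w)| `^ m).
    by apply: measurable_norm_powR; exact: (measurableT_comp mf).
  apply: (@le_trans _ _ (\int[P]_w (1 + ((expR lam - 1) * t `^ (- m))%:E *
      (`|f (V i w)| `^ m)%:E))%E).
    apply: ge0_le_integral => //.
    - apply/measurable_EFinP; apply: measurableT_comp => //.
      exact: (measurableT_comp my).
    - apply: emeasurable_funD => //; apply: emeasurable_funM => //.
      exact/measurable_EFinP.
    move=> w _; rewrite -EFinM -EFinD lee_fin /y; set x := `|f _|.
    have x0 : 0 <= x `^ m by exact: powR_ge0.
    have [tx|_] := ltP t x; last first.
      by rewrite mulr0 expR0 lerDl mulr_ge0// mulr_ge0// ltW.
    have : 1 <= t `^ (- m) * x `^ m.
      rewrite powRN mulrC ler_pdivlMr ?powR_gt0// mul1r.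
      by apply: ge0_ler_powR; rewrite ?nnegrE ?ltW// (lt_trans t0).
    by rewrite mulr1; nra.
  rewrite ge0_integralD//; last 2 first.
  - by move=> w _; rewrite -EFinM lee_fin mulr_ge0 ?powR_ge0// mulr_ge0// ltW.
  - by apply: emeasurable_funM => //; exact/measurable_EFinP.
  rewrite ge0_integralZl_EFin//; last 2 first.
  - exact/measurable_EFinP.
  - by rewrite mulr_ge0// ltW.
  have -> : (\int[P]_w (1 : \bar R) = 1)%E.
    by have := expectation_cst P 1; rewrite unlock.
  apply: (@le_trans _ _ (1 + ((expR lam - 1) * t `^ (- m))%:E * 1)%E).
    by rewrite leeD// lee_wpmul2l// lee_fin mulr_ge0// ltW.
  by rewrite mule1 -EFinD lee_fin expR_ge1Dx.
- move=> w /negP; rewrite -ltNge; apply: le_lt_trans.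
  by rewrite natr_card_sum mulr_sumr.
Qed.

End counts.

(** * Order statistics as counts, and the deterministic effect of winsorizing *)

Section order_statistics.
Context {R : realType}.
Implicit Types (n k : nat) (x : R).

Let count_sort_codom n (v : 'I_n -> R) (p : pred R) :
  count p (sort <=%R (codom v)) = #|[set i | p (v i)]%SET|.
Proof.
have /permP -> : perm_eq (sort <=%R (codom v)) (codom v) by rewrite perm_sort.
rewrite count_map -sum1_card -sum1_count big_enum_cond.
by apply: eq_bigl => i; rewrite inE.
Qed.

Let size_sort_codom n (v : 'I_n -> R) : size (sort <=%R (codom v)) = n.
Proof. by rewrite size_sort size_codom card_ord. Qed.

Let sorted_codom n (v : 'I_n -> R) : sorted <=%R (sort <=%R (codom v)).
Proof. exact: sort_le_sorted. Qed.

Let le_count (s : seq R) (p : pred R) i : sorted <=%R s -> (i < size s)%N ->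
  (forall x y, x <= y -> p y -> p x) -> p (nth 0 s i) -> (i < count p s)%N.
Proof.
move=> ss i_s pmono pi; apply: (@leq_trans (count p (take i.+1 s))); last first.
  by rewrite -[in X in (_ <= X)%N](cat_take_drop i.+1 s) count_cat leq_addr.
have /eqP -> : count p (take i.+1 s) == size (take i.+1 s).
  rewrite -all_count; apply/(all_nthP 0) => j; rewrite size_takel// => ji.
  rewrite nth_take//; apply: pmono pi.
  by apply: le_sorted_leq_nth => //; rewrite inE (leq_ltn_trans _ i_s).
by rewrite size_takel.
Qed.

(** Trades sorting for counting. Ranks from 1 to [n] keep [nth] off its default value 0. *)
Lemma order_stat_le n (v : 'I_n -> R) k x : (0 < k <= n)%N ->
  (order_stat v k <= x) = (k <= #|[set i | (v i <= x)%R]%SET|)%N.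
Proof.
case: k => // k /= kn; rewrite -(count_sort_codom v (fun y => y <= x)).
apply/idP/idP => [h|]; last exact: nth_count_le.
apply: le_count => //; first by rewrite size_sort_codom.
by move=> y z; exact: le_trans.
Qed.

Lemma order_stat_lt n (v : 'I_n -> R) k x : (0 < k <= n)%N ->
  (order_stat v k < x) = (k <= #|[set i | (v i < x)%R]%SET|)%N.
Proof.
case: k => // k /= kn; rewrite -(count_sort_codom v (fun y => y < x)).
apply/idP/idP => [h|]; last exact: nth_count_lt.
apply: le_count => //; first by rewrite size_sort_codom.
by move=> y z; exact: le_lt_trans.
Qed.

Lemma card_set_lt_le n (v : 'I_n -> R) x :
  (#|[set i | (v i <= x)%R]%SET| + #|[set i | (x < v i)%R]%SET|)%N = n.
Proof.
rewrite -[RHS]card_ord -(cardsC [set i | (v i <= x)%R]%SET).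
by congr (_ + _)%N; apply: eq_card => i; rewrite !inE ltNge.
Qed.

(** The arguments of ceiling and floor are nonnegative, so the absolute values in the ranks are
    harmless. The last two conjuncts are the rounding errors that the counting arguments absorb. *)
Lemma winsor_ranks n (eps : R) : (0 < n)%N -> 0 < eps < 1 / 2 ->
  let kl := `|Num.ceil (eps * n%:R)|%N in
  let kh := (`|Num.floor ((1 - eps) * n%:R)|%N).+1 in
  [/\ (0 < kl <= n)%N, (0 < kh <= n)%N, (kl <= kh)%N,
    eps * n%:R <= kl%:R /\ kl%:R < eps * n%:R + 1 &
    (1 - eps) * n%:R < kh%:R /\ kh%:R <= (1 - eps) * n%:R + 1].
Proof.
move=> n0 /andP[e0 e2] kl kh.
have nR : 0 < n%:R :> R by rewrite ltr0n.
have en0 : 0 < eps * n%:R by rewrite mulr_gt0.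
have fn0 : 0 <= (1 - eps) * n%:R by rewrite mulr_ge0// ?ltW//; lra.
have klE : kl%:R = (Num.ceil (eps * n%:R))%:~R :> R.
  by rewrite /kl natr_absz ger0_norm// ceil_ge0; lra.
have khE : kh%:R = (Num.floor ((1 - eps) * n%:R))%:~R + 1 :> R.
  by rewrite /kh -natr1 natr_absz ger0_norm// floor_ge0.
have /andP[cl cu] := ceil_itv (eps * n%:R).
have /andP[fl fu] := floor_itv ((1 - eps) * n%:R).
have kl1 : eps * n%:R <= kl%:R by rewrite klE.
have kl2 : kl%:R < eps * n%:R + 1 by move: cl; rewrite klE intrB; lra.
have kh1 : (1 - eps) * n%:R < kh%:R by move: fu; rewrite khE intrD; lra.
have kh2 : kh%:R <= (1 - eps) * n%:R + 1 by rewrite khE; lra.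
split => //.
- rewrite -(ltr0n R) (lt_le_trans en0 kl1)/= -ltnS -(ltr_nat R) -natr1.
  by apply: (lt_le_trans kl2); rewrite lerD2r ger_pMl//; lra.
- apply/andP; split => //; rewrite -ltnS -(ltr_nat R) -natr1; apply: (le_lt_trans kh2).
  by rewrite ltrD2r gtr_pMl//; lra.
- rewrite -ltnS -(ltr_nat R) -natr1; apply: (lt_trans kl2); rewrite ltrD2r.
  by apply: le_lt_trans kh1; rewrite ler_pM2r//; lra.
Qed.

(** Fewer than eps n observed values are further than [t] from [mu], being contaminated or large
    from the start; this is too few to push a winsorization point outside [mu - t, mu + t]. Nothing
    moves except at contaminated indices and at values below [a] or above [b], each at most eps n in
    number. *)
Lemma winsorized_compare n (eps eta mu t : R) (v u : 'I_n -> R) :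
  (0 < n)%N -> 0 < eps < 1 / 2 ->
  #|[set i | v i != u i]%SET|%:R <= eta * n%:R ->
  #|[set i | (t < `|u i - mu|)%R]%SET|%:R < (eps - eta) * n%:R ->
  (forall i, `|winsorized eps v i - mu| <= t) /\
  #|[set i | winsorized eps v i - mu != winsorize (- t) t (u i - mu)]%SET|%:R
    <= 3 * eps * n%:R.
Proof.
move=> n0 eps12; set D := [set i | v i != u i]%SET.
set O := [set i | (t < `|u i - mu|)%R]%SET => hD hO.
have [] := winsor_ranks n0 eps12.
set kl := `|_|%N; set kh := (`|_|%N).+1.
move=> kln khn klh [kl1 kl2] [kh1 kh2].
have nR : 0 < n%:R :> R by rewrite ltr0n.
have out (p : pred 'I_n) : (forall i, p i -> t < `|v i - mu|) ->
    #|[set i | p i]%SET|%:R < eps * n%:R :> R.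
  move=> pt; apply: (@le_lt_trans _ _ (#|D|%:R + #|O|%:R)); last lra.
  rewrite -natrD ler_nat (leq_trans _ (leq_card_setU D O))// subset_leq_card//.
  apply/fintype.subsetP => i; rewrite !inE => /pt; have [->//|//] := eqVneq (v i) (u i).
set a := winsor_lo eps v; set b := winsor_hi eps v.
have ha : mu - t <= a.
  rewrite leNgt order_stat_lt// -/kl -ltnNge -(ltr_nat R) (lt_le_trans _ kl1)//.
  apply: out => i vi; rewrite ltr_normr; apply/orP; right; lra.
have hb : b <= mu + t.
  (* More than (1 - eps) n values are at most mu + t, while [kh] is at most (1 - eps) n + 1;
     strictness absorbs the 1. *)
  rewrite order_stat_le// -/kh -ltnS -(ltr_nat R) -natr1.
  have h : #|[set i | (mu + t < v i)%R]%SET|%:R < eps * n%:R :> R.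
    by apply: out => i vi; rewrite ltr_normr; apply/orP; left; lra.
  have := card_set_lt_le v (mu + t); move/(congr1 (fun k => k%:R : R)).
  rewrite natrD; lra.
have bb : (kh <= #|[set i | (v i <= b)%R]%SET|)%N by rewrite -order_stat_le.
have ab : a <= b by rewrite order_stat_le// (leq_trans klh).
have na : #|[set i | (v i < a)%R]%SET|%:R <= eps * n%:R.
  (* Fewer than [kl] values lie strictly below the [kl]-th smallest, and rounding up costs less than
     1. *)
  have : (#|[set i | (v i < a)%R]%SET|.+1 <= kl)%N.
    by rewrite ltnNge -order_stat_lt// ltxx.
  rewrite -(ler_nat R) -natr1; lra.
have nb : #|[set i | (b < v i)%R]%SET|%:R <= eps * n%:R.
  have := card_set_lt_le v b; move/(congr1 (fun k => k%:R : R)).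
  move: bb; rewrite -(ler_nat R) natrD; lra.
have Wab x : a <= winsorize a b x <= b.
  rewrite /winsorize; case: ltP => xa; first by rewrite lexx.
  by case: ltP => xb; rewrite ?lexx ?ab// xa xb.
split.
  move=> i; have /andP[wa wb] := Wab (v i).
  by rewrite ler_norml /winsorized -/a -/b; apply/andP; split; lra.
set M := [set i | _]%SET.
apply: (@le_trans _ _ (#|D|%:R + #|[set i | (v i < a)%R]%SET|%:R +
    #|[set i | (b < v i)%R]%SET|%:R)).
  rewrite -!natrD ler_nat; apply: leq_trans (leq_trans (leq_card_setU _ _)
    (leq_add (leq_card_setU _ _) (leqnn _))).
  rewrite subset_leq_card//; apply/fintype.subsetP => i; rewrite !inE.
  apply: contraR; rewrite !negb_or negbK -!leNgt => /andP[/andP[/eqP vu av] vb].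
  rewrite /winsorized -/a -/b {1}/winsorize !ltNge av vb/= vu winsorize_id//.
  by rewrite ler_norml -vu; apply/andP; split; lra.
have O0 : 0 <= #|O|%:R :> R by exact: ler0n.
(* A count below (eps - eta) n forces eta <= eps, so the contaminated indices also number at most
   eps n. *)
have : eta * n%:R <= eps * n%:R by move: hO; rewrite mulrBl; lra.
lra.
Qed.

End order_statistics.

(** * Averages and sample covariances when few indices change *)

Section averages.
Context {R : realType}.
Implicit Types (n : nat).

Lemma average_perturbation n (F G : 'I_n -> R) (S : {set 'I_n}) (k c : R) :
  (0 < n)%N -> #|S|%:R <= k * n%:R -> 0 <= c ->
  (forall i, i \notin S -> F i = G i) -> (forall i, `|F i - G i| <= c) ->
  `|n%:R^-1 * (\sum_(i < n) F i) - n%:R^-1 * (\sum_(i < n) G i)| <= k * c.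
Proof.
move=> n0 Sk c0 FG FGc; have nR : 0 < n%:R :> R by rewrite ltr0n.
rewrite -mulrBr normrM ger0_norm ?invr_ge0 ?(ltW nR)// ler_pdivrMl//.
rewrite -sumrB (le_trans (ler_norm_sum _ _ _))//.
apply: (@le_trans _ _ (\sum_(i in S) c)).
  rewrite [X in _ <= X]big_mkcond/=; apply: ler_sum => i _.
  by case: ifPn => [_|/FG ->]; rewrite ?subrr ?normr0.
by have := ler_wpM2r c0 Sk; rewrite sumr_const -mulr_natr; lra.
Qed.

(** Shifts do not affect a sample covariance, so the data may be centred at the true means; the
    empirical centring then survives only as a product of two small averages. *)
Lemma covariance_affine n (b mu mu' : R) (W W' w w' : 'I_n -> R) :
  (0 < n)%N -> (forall i, W i = mu + b * w i) ->
  (forall i, W' i = mu' + b * w' i) ->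
  let avg (F : 'I_n -> R) := n%:R^-1 * \sum_(i < n) F i in
  avg (fun i => (W i - avg W) * (W' i - avg W')) =
  b ^+ 2 * (avg (fun i => w i * w' i) - avg w * avg w').
Proof.
move=> n0 WE WE' avg; have nR : n%:R != 0 :> R by rewrite pnatr_eq0 -lt0n.
have avgE (c : R) (F f : 'I_n -> R) : (forall i, F i = c + b * f i) ->
    avg F = c + b * avg f.
  move=> FE; rewrite /avg; under eq_bigr do rewrite FE.
  rewrite big_split/= sumr_const card_ord -mulr_sumr -mulr_natr.
  by field.
rewrite (avgE _ _ _ WE) (avgE _ _ _ WE').
have -> : avg (fun i => (W i - (mu + b * avg w)) * (W' i - (mu' + b * avg w'))) =
    avg (fun i => b ^+ 2 * (avg w * avg w') + b ^+ 2 *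
      (w i * w' i - avg w * w' i - avg w' * w i)).
  rewrite /avg; congr (_ * _); apply: eq_bigr => i _; rewrite WE WE'.
  by ring.
rewrite {1}/avg big_split/= sumr_const card_ord -mulr_sumr !sumrB -!mulr_sumr.
rewrite -[in LHS](mulr_natr _ n) /avg.
by field.
Qed.

(** [w] stands for winsorized observed values, [z] for clamped uncontaminated ones. Products differ
    by at most 2 T^2 at no more than 2 k n indices, and single values by at most 2 T at no more than
    k n; the product of the averages contributes the square. *)
Lemma sample_covariance_perturbation n (T k delta rho : R)
    (w w' z z' : 'I_n -> R) :
  let avg (F : 'I_n -> R) := n%:R^-1 * \sum_(i < n) F i in
  (0 < n)%N -> 0 <= T -> 0 <= k ->
  (forall i, `|w i| <= T) -> (forall i, `|w' i| <= T) ->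
  (forall i, `|z i| <= T) -> (forall i, `|z' i| <= T) ->
  #|[set i | w i != z i]%SET|%:R <= k * n%:R ->
  #|[set i | w' i != z' i]%SET|%:R <= k * n%:R ->
  `|avg (fun i => z i * z' i) - rho| <= delta ->
  `|avg z| <= delta -> `|avg z'| <= delta ->
  `|avg (fun i => w i * w' i) - avg w * avg w' - rho| <=
    delta + 4 * k * T ^+ 2 + (delta + 2 * k * T) ^+ 2.
Proof.
move=> avg n0 T0 k0 wT wT' zT zT' wz wz' zz z1 z1'.
have near (f g : 'I_n -> R) : (forall i, `|f i| <= T) -> (forall i, `|g i| <= T) ->
    #|[set i | f i != g i]%SET|%:R <= k * n%:R -> `|avg g| <= delta ->
    `|avg f| <= delta + 2 * k * T.
  move=> fT gT fg gd.
  have : `|avg f - avg g| <= k * (2 * T).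
    apply: (average_perturbation n0 fg); first by lra.
      by move=> i; rewrite inE negbK => /eqP.
    by move=> i; rewrite (le_trans (ler_normB _ _))//; have := fT i; have := gT i; lra.
  have := ler_normD (avg f - avg g) (avg g); rewrite subrK; lra.
have A := near _ _ wT zT wz z1; have A' := near _ _ wT' zT' wz' z1'.
have B : `|avg (fun i => w i * w' i) - avg (fun i => z i * z' i)| <=
    2 * k * (2 * T ^+ 2).
  apply: (@average_perturbation _ _ _ ([set i | w i != z i] :|: [set i | w' i != z' i])%SET) => //.
  - apply: (@le_trans _ _ (#|[set i | w i != z i]%SET|%:R + #|[set i | w' i != z' i]%SET|%:R)).
      by rewrite -natrD ler_nat leq_card_setU.
    by lra.
  - by rewrite mulr_ge0// sqr_ge0.
  - by move=> i; rewrite !inE negb_or !negbK => /andP[/eqP -> /eqP ->].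
  - move=> i; rewrite (le_trans (ler_normB _ _))// !normrM expr2.
    have : `|w i| * `|w' i| <= T * T by rewrite ler_pM.
    have : `|z i| * `|z' i| <= T * T by rewrite ler_pM.
    by lra.
have AA : `|avg w * avg w'| <= (delta + 2 * k * T) ^+ 2.
  by rewrite normrM expr2 ler_pM.
set p := avg (fun i => w i * w' i) in B *; set q := avg (fun i => z i * z' i) in B zz.
have -> : p - avg w * avg w' - rho = (p - q) + (q - rho) - avg w * avg w' by ring.
rewrite (le_trans (ler_normB _ _))// (le_trans (lerD (ler_normD _ _) (lexx _)))//.
lra.
Qed.

End averages.

(** * Truncation level and rates *)

Section rates.
Context {R : realType}.
Implicit Types (m c eps : R).

(** The level T at which Markov's tail bound T^(-m), for an [m]-th moment at most 1, equals c
    eps. *)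
Definition trunc_level m c eps : R := (c * eps) `^ (- m^-1).

Lemma trunc_level_powRN m c eps : 0 < m -> 0 < c * eps ->
  trunc_level m c eps `^ (- m) = c * eps.
Proof.
by move=> m0 ce0; rewrite -powRrM mulrNN mulVf ?gt_eqF// powRr1// ltW.
Qed.

Lemma powR_le1 (p x : R) : 0 <= p -> 0 <= x <= 1 -> x `^ p <= 1.
Proof.
move=> p0 /andP[x0 x1]; apply: (@le_trans _ _ (1 `^ p)); last by rewrite powR1.
by apply: ge0_ler_powR; rewrite ?nnegrE.
Qed.

Lemma trunc_level_ge1 m c eps : 0 < m -> 0 < c * eps <= 1 ->
  1 <= trunc_level m c eps.
Proof.
move=> m0 /andP[ce0 ce1]; rewrite /trunc_level powRN invf_ge1 ?powR_gt0//.
by apply: powR_le1; rewrite ?invr_ge0 ?(ltW m0)// (ltW ce0).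
Qed.

Lemma trunc_level_powR2 m c eps : 0 < m -> 0 < c * eps ->
  trunc_level m c eps `^ (2 - m) = (c * eps) `^ (1 - 2 / m).
Proof.
by move=> m0 ce0; rewrite -powRrM; congr (_ `^ _); field; rewrite gt_eqF.
Qed.

Lemma trunc_level_sqr m c eps : 0 < m -> 0 < c * eps ->
  trunc_level m c eps ^+ 2 = (c * eps) `^ (- (2 / m)).
Proof.
move=> m0 ce0; rewrite -powR_mulrn ?powR_ge0// -powRrM.
by congr (_ `^ _); rewrite mulNr mulrC.
Qed.

(** The balance behind the level: a fraction eps of wrong indices, at T^2 each, costs as much as the
    truncation bias up to 1 / c. *)
Lemma eps_trunc_level_sqr m c eps : 0 < m -> 0 < c -> 0 < eps ->
  eps * trunc_level m c eps ^+ 2 = c^-1 * trunc_level m c eps `^ (2 - m).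
Proof.
move=> m0 c0 e0; have ce0 : 0 < c * eps by rewrite mulr_gt0.
rewrite trunc_level_sqr// trunc_level_powR2// powRD; last first.
  by rewrite (gt_eqF ce0) implybT.
by rewrite powRr1 ?ltW// mulrA mulrA mulVf ?gt_eqF// mul1r.
Qed.

Lemma powRD_le (p x y : R) : 0 <= p -> 0 <= x -> 0 <= y ->
  (x + y) `^ p <= (2 * x) `^ p + (2 * y) `^ p.
Proof.
move=> p0 x0 y0; wlog xy : x y x0 y0 / x <= y => [H|].
  by have [xy|/ltW yx] := leP x y; [exact: H|rewrite addrC [X in _ <= X]addrC; exact: H].
rewrite -[X in X <= _]add0r lerD ?powR_ge0// ge0_ler_powR ?nnegrE; lra.
Qed.

(** The exponent [p] is the smaller of 1 - 2/m and 1/2, and L <= 1, so L^p dominates every power of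
    L that occurs. The uniform bound [Q <= K] later reduces the square of the mean error to a
    multiple of Q. *)
Lemma dev_rate_le m (l1 l2 : R) c : 2 < m -> 0 < l1 -> 0 < l2 -> 0 < c <= 1 ->
  exists2 K, 0 < K & forall eta L L', 0 <= eta <= 1 -> 0 < L <= 1 -> L <= 2 * L' ->
    let Q := dev_rate m (trunc_level m c (l1 * eta + l2 * L)) L in
    Q <= K /\
    Q <= K * (eta `^ (1 - 2 / m) + L' `^ (1 - (Num.min (m / 2) 2)^-1)).
Proof.
move=> m2 l10 l20 /andP[c0 c1]; have m0 : 0 < m by lra.
set p1 := 1 - 2 / m; set p := 1 - _.
have m2_ : 0 < 2 / m < 1 by rewrite divr_gt0//= ltr_pdivrMr// mul1r.
have [p10 p11] : 0 < p1 /\ p1 < 1 by move: m2_; rewrite /p1 => /andP[]; split; lra.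
have min1 : 1 < Num.min (m / 2) 2.
  by rewrite lt_min ltr_pdivlMr//; apply/andP; split; lra.
have pp1 : p <= p1.
  rewrite /p /p1 lerD2l lerN2 -[2 / m]invrK lef_pV2 ?posrE; last 2 first.
  - by rewrite invr_gt0; case/andP: m2_.
  - by lra.
  by rewrite invf_div ge_min lexx.
have p2 : p <= 2^-1.
  have : 2^-1 <= (Num.min (m / 2) 2)^-1.
    by rewrite lef_pV2 ?posrE ?ge_min ?lexx ?orbT//; lra.
  rewrite /p; lra.
have p0 : 0 <= p.
  have : (Num.min (m / 2) 2)^-1 <= 1 by rewrite invf_le1 ?ltW//; lra.
  rewrite /p; lra.
pose A := (2 * l1) `^ p1; pose B := (2 * l2) `^ p1; pose D := (c * l2) `^ (- (2 / m)).
have A0 : 0 < A by rewrite powR_gt0 ?mulr_gt0.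
have B0 : 0 < B by rewrite powR_gt0 ?mulr_gt0.
have D0 : 0 < D by rewrite powR_gt0 ?mulr_gt0.
(* [A] and [B] come from splitting the bias between [eta] and [L], 1 from sqrt L, [D] from L T^2;
   the factor 2 pays for L <= 2 L'. *)
exists (A + 2 * (B + 1 + D)); first lra.
move=> eta L L' /andP[eta0 eta1] /andP[L0 L1] LL' Q.
have eps0 : 0 < l1 * eta + l2 * L by rewrite ltr_wpDl ?mulr_gt0// mulr_ge0// ltW.
have ce0 : 0 < c * (l1 * eta + l2 * L) by rewrite mulr_gt0.
have Lmono q : p <= q -> L `^ q <= L `^ p by move=> pq; apply: ger_powR; rewrite ?L0.
have Lp0 : 0 <= L `^ p by exact: powR_ge0.
have Lp1 : L `^ p <= 1 by apply: powR_le1; rewrite ?(ltW L0).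
have Ep0 : 0 <= eta `^ p1 by exact: powR_ge0.
have Ep1 : eta `^ p1 <= 1.
  by apply: powR_le1; rewrite ?(ltW p10) ?eta0.
have Q1 : Q <= A * eta `^ p1 + (B + 1 + D) * L `^ p.
  have h1 : trunc_level m c (l1 * eta + l2 * L) `^ (2 - m) <=
      A * eta `^ p1 + B * L `^ p.
    rewrite trunc_level_powR2// -/p1.
    apply: (@le_trans _ _ ((l1 * eta + l2 * L) `^ p1)).
      apply: ge0_ler_powR; rewrite ?nnegrE ?(ltW p10) ?(ltW ce0) ?(ltW eps0)//.
      by rewrite ler_piMl// ltW.
    apply: (le_trans (powRD_le _ _ _)); rewrite ?mulr_ge0 ?(ltW p10) ?(ltW l10) ?(ltW l20) ?(ltW L0)//.
    rewrite !mulrA powRM ?mulr_ge0 ?(ltW l10)// [X in _ + X <= _]powRM ?mulr_ge0 ?(ltW l20) ?(ltW L0)//.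
    by rewrite lerD2l ler_wpM2l ?(ltW B0)// Lmono.
  have h2 : Num.sqrt L <= L `^ p.
    by rewrite -powR12_sqrt ?(ltW L0)// Lmono.
  have h3 : L * trunc_level m c (l1 * eta + l2 * L) ^+ 2 <= D * L `^ p.
    rewrite trunc_level_sqr//.
    (* The exponent is negative, so dropping [eta] from the base only increases the power. *)
    apply: (@le_trans _ _ (L * (c * l2 * L) `^ (- (2 / m)))).
      rewrite ler_wpM2l ?(ltW L0)// !powRN lef_pV2 ?posrE ?powR_gt0 ?mulr_gt0//.
      have [m2p _] := andP m2_.
      apply: ge0_ler_powR; rewrite ?nnegrE ?(ltW m2p) ?(ltW ce0)//.
        by rewrite !mulr_ge0// ltW.
      by rewrite -mulrA ler_pM2l// lerDr mulr_ge0// ltW.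
    rewrite powRM ?mulr_ge0 ?(ltW c0) ?(ltW l20) ?(ltW L0)// mulrCA ler_wpM2l ?(ltW D0)//.
    rewrite -{1}(powRr1 (ltW L0)) -powRD ?(gt_eqF L0) ?implybT//.
    exact: Lmono.
  rewrite /Q /dev_rate; lra.
split; first by apply: (le_trans Q1); nra.
have L'0 : 0 <= L' by lra.
have LL : L `^ p <= 2 * L' `^ p.
  apply: (@le_trans _ _ ((2 * L') `^ p)).
    by apply: ge0_ler_powR; rewrite ?nnegrE ?mulr_ge0 ?(ltW L0).
  rewrite powRM// ler_wpM2r ?powR_ge0//.
  by rewrite -[X in _ <= X]powRr1//; apply: ler_powR; rewrite ?ler1n//; lra.
have L'p0 : 0 <= L' `^ p by exact: powR_ge0.
apply: (le_trans Q1); nra.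
Qed.

End rates.

(** * Measurability of the estimators *)

Section measurability.
Context {dT : measure_display} {T : measurableType dT} {R : realType}.

(** An open ray below r pulls back to the event that at least [k] of the [v i] are below r, and this
    count is a sum of indicators. *)
Lemma measurable_order_stat n k (v : 'I_n -> T -> R) : (0 < k <= n)%N ->
  (forall i, measurable_fun setT (v i)) ->
  measurable_fun setT (fun w => order_stat (fun i => v i w) k).
Proof.
move=> kn mv; apply: (measurability _ (RGenInftyO.measurableE R)) => //.
move=> /= _ [_ [r ->] <-]; rewrite setTI.
rewrite (_ : _ @^-1` _ =
    [set w | k%:R <= \sum_(i < n) (if v i w < r then 1 else 0) :> R]).
  rewrite -[X in measurable X]setTI; apply: measurable_fun_le => //.
  apply: measurable_sum => i; apply: measurable_fun_ifT => //.
  exact: measurable_fun_ltr.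
have sumE w : \sum_(i < n) (if v i w < r then 1 else 0) =
    #|[set i | v i w < r]%SET|%:R :> R.
  by rewrite natr_card_sum; apply: eq_bigr => i _; case: ifP.
by apply/seteqP; split => w /=; rewrite in_itv/= order_stat_lt// -(ler_nat R) sumE.
Qed.

Lemma measurable_winsorize2 (a b f : T -> R) :
  measurable_fun setT a -> measurable_fun setT b -> measurable_fun setT f ->
  measurable_fun setT (fun w => winsorize (a w) (b w) (f w)).
Proof.
move=> ma mb mf; apply: measurable_fun_ifT => //; first exact: measurable_fun_ltr.
by apply: measurable_fun_ifT => //; exact: measurable_fun_ltr.
Qed.

Lemma measurable_winsorized n (eps : R) (v : 'I_n -> T -> R) i :
  0 < eps < 1 / 2 -> (forall i, measurable_fun setT (v i)) ->
  measurable_fun setT (fun w => winsorized eps (fun i => v i w) i).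
Proof.
move=> e12 mv; have n0 : (0 < n)%N by case: n i {v mv} => [[]|].
have [kl kh _ _ _] := winsor_ranks n0 e12.
by apply: measurable_winsorize2 => //; exact: measurable_order_stat.
Qed.

Lemma measurable_winsor_cov d n (eps : R) (V : 'I_n -> T -> d.-tuple R) j k :
  0 < eps < 1 / 2 -> (forall i, measurable_fun setT (V i)) ->
  measurable_fun setT (fun w => winsor_cov eps (fun i => V i w) j k).
Proof.
move=> e12 mV; have mt l i : measurable_fun setT (fun w => tnth (V i w) l).
  by apply: (measurableT_comp (measurable_tnth l)).
have mw l i : measurable_fun setT
    (fun w => winsorized eps (fun i => tnth (V i w) l) i).
  exact: (@measurable_winsorized n eps (fun i w => tnth (V i w) l)).
have mm l : measurable_fun setT
    (fun w => winsor_mean eps (fun i => tnth (V i w) l)).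
  by apply: measurable_funM => //; exact: measurable_sum.
under eq_fun do rewrite mxE.
apply: measurable_funM => //; apply: measurable_sum => i.
by apply: measurable_funM; exact: measurable_funB.
Qed.

Lemma measurable_bigmaxr (I : Type) (s : seq I) (h : I -> T -> R) :
  (forall i, measurable_fun setT (h i)) ->
  measurable_fun setT (fun w => \big[Num.max/0]_(i <- s) h i w).
Proof.
move=> mh; elim: s => [|i s IH].
  by under eq_fun do rewrite big_nil; exact: measurable_cst.
by under eq_fun do rewrite big_cons; exact: measurable_maxr.
Qed.

Lemma measurable_max_entry d (A : T -> 'M[R]_d) :
  (forall j k, measurable_fun setT (fun w => A w j k)) ->
  measurable_fun setT (fun w => max_entry (A w)).
Proof.
move=> mA.
apply: (@measurable_bigmaxr _ _ (fun j w => \big[Num.max/0]_k `|A w j k|)) => j.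
apply: (@measurable_bigmaxr _ _ (fun k w => `|A w j k|)) => k.
exact: (measurableT_comp _ (mA j k)).
Qed.

End measurability.

(** * Standardized observations and their moments *)

Definition standardize {R : realType} {d : nat} (b : R) (mu : 'I_d -> R)
    (j : 'I_d) (x : d.-tuple R) : R :=
  (tnth x j - mu j) / b.

Lemma measurable_standardize {R : realType} {d : nat} (b : R) (mu : 'I_d -> R) j :
  measurable_fun setT (standardize b mu j).
Proof.
apply: measurable_funM => //; apply: measurable_funB => //.
exact: measurable_tnth.
Qed.

Section standardized_moments.
Context {dT : measure_display} {T : measurableType dT} {R : realType}.
Variable P : probability T R.
Context {d n : nat} {m b1 b eta : R} {mu : 'I_d -> R} {Sigma : 'M[R]_d}.
Variables V V' : 'I_n -> {RV P >-> d.-tuple R}.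
Hypotheses (m0 : 0 < m) (b0 : 0 < b).
Hypothesis cm : contamination_model m b1 b eta mu Sigma V V'.

Let mV i j : measurable_fun setT (fun w => standardize b mu j (V i w)).
Proof. exact: (measurableT_comp (measurable_standardize b mu j)). Qed.

Let mvc i j : measurable_fun setT (vcoord V i j).
Proof. exact: (measurableT_comp (measurable_tnth j)). Qed.

(** This is why standardizing divides by the moment bound [b] and not by the standard deviation. *)
Lemma standardize_moment i j :
  (\int[P]_w (`|standardize b mu j (V i w)| `^ m)%:E <= 1)%E.
Proof.
have mD : measurable_fun setT (fun w => `|vcoord V i j w - mu j| `^ m).
  by apply: measurable_norm_powR; exact: measurable_funB.
have N : (\int[P]_w (`|vcoord V i j w - mu j| `^ m)%:E <= (b `^ m)%:E)%E.
  have -> : (\int[P]_w (`|vcoord V i j w - mu j| `^ m)%:E =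
      'N[P]_m%:E[EFin \o (fun w => vcoord V i j w - mu j)%R] `^ m)%E.
    by rewrite powR_Lnorm ?lt0r_neq0//; apply: eq_integral => w _ /=; rewrite poweR_EFin.
  rewrite -poweR_EFin gt0_ler_poweR ?(ltW m0)//.
  - by rewrite in_itv/= Lnorm_ge0 leey.
  - by rewrite in_itv/= lee_fin ltW//= leey.
  - exact: (cm_upper cm).
have E w : (`|standardize b mu j (V i w)| `^ m)%:E =
    ((b `^ m)^-1%:E * (`|vcoord V i j w - mu j| `^ m)%:E)%E.
  rewrite -EFinM /standardize normrM powRM// (ger0_norm (x := b^-1)) ?invr_ge0 ?ltW//.
  by rewrite -(powR_inv1 (ltW b0)) -powRrM mulN1r powRN mulrC.
under eq_integral do rewrite E.
rewrite ge0_integralZl_EFin//; last 2 first.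
- exact/measurable_EFinP.
- by rewrite invr_ge0 powR_ge0.
apply: (@le_trans _ _ ((b `^ m)^-1%:E * (b `^ m)%:E)%E).
  by rewrite lee_wpmul2l// lee_fin invr_ge0 powR_ge0.
by rewrite -EFinM mulVf// gt_eqF// powR_gt0.
Qed.

Let integrable_vcoord i j : P.-integrable setT (EFin \o vcoord V i j).
Proof.
apply/integrableP; split; first exact/measurable_EFinP.
under eq_integral do rewrite /=.
(* A real mean forces integrability: without it the integral would be infinite. *)
rewrite integral_fin_num_abs//.
by have := cm_mean cm i j; rewrite unlock => ->.
Qed.

(** The factor 1 gives the mean the form of a product, to be used with [rho = 0] in the
    concentration bound. *)
Lemma standardize_mean i j : (\int[P]_w (standardize b mu j (V i w) * 1)%:E = 0%:E)%E.
Proof.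
have E w : (standardize b mu j (V i w) * 1)%:E =
    (b^-1%:E * ((vcoord V i j w)%:E + (- mu j)%:E))%E.
  by rewrite mulr1 -EFinD -EFinM mulrC.
have ic : P.-integrable setT (fun _ : T => (- mu j)%:E) by exact: integrable_cstR.
under eq_integral do rewrite E.
rewrite integralZl//; last by apply: integrableD => //; exact: integrable_vcoord.
rewrite integralD//; last exact: integrable_vcoord.
have := cm_mean cm i j; rewrite unlock => ->.
have := expectation_cst P (- mu j); rewrite unlock => ->.
by rewrite -EFinD subrr mule0.
Qed.

Lemma standardize_prod i j k : 2 < m ->
  (\int[P]_w (standardize b mu j (V i w) * standardize b mu k (V i w))%:E =
   (Sigma j k / b ^+ 2)%:E)%E.
Proof.
move=> m2; have E w : (standardize b mu j (V i w) * standardize b mu k (V i w))%:E =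
    ((b ^- 2)%:E * ((vcoord V i j w - mu j) * (vcoord V i k w - mu k))%:E)%E.
  rewrite -EFinM /standardize /vcoord; congr EFin; field; exact: lt0r_neq0.
have I0 : P.-integrable setT
    (EFin \o (fun w => standardize b mu j (V i w) * standardize b mu k (V i w))).
  by apply: (integrable_prod m2) => //; exact: standardize_moment.
have I1 : P.-integrable setT
    (fun w => ((vcoord V i j w - mu j) * (vcoord V i k w - mu k))%:E).
  have -> : (fun w => ((vcoord V i j w - mu j) * (vcoord V i k w - mu k))%:E) =
    (fun w => (b ^+ 2)%:E * (standardize b mu j (V i w) * standardize b mu k (V i w))%:E)%E.
    apply/funext => w; rewrite E muleA -EFinM mulfV ?expf_neq0 ?gt_eqF//.
    by rewrite mul1r.
  exact: integrableZl.
under eq_integral do rewrite E.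
rewrite integralZl//.
have := cm_cov cm i j k; rewrite unlock.
rewrite !(cm_mean cm)/= unlock => H.
rewrite (_ : (\int[P]_w _)%E = (Sigma j k)%:E); last first.
  by rewrite -H; apply: eq_integral.
by rewrite -EFinM mulrC.
Qed.

End standardized_moments.

(** * The bound for one sample *)

Section one_sample.
Context {R : realType}.

Lemma winsorize_mull (b t x : R) : 0 < b ->
  winsorize (- (b * t)) (b * t) (b * x) = b * winsorize (- t) t x.
Proof.
move=> b0; rewrite /winsorize -mulrN !ltr_pM2l//.
by case: ifP => // _; case: ifP.
Qed.

Lemma winsorized_standardize n (eps eta mu b t : R) (v u : 'I_n -> R) :
  (0 < n)%N -> 0 < eps < 1 / 2 -> 0 < b ->
  #|[set i | v i != u i]%SET|%:R <= eta * n%:R ->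
  #|[set i | (t < `|(u i - mu) / b|)%R]%SET|%:R < (eps - eta) * n%:R ->
  (forall i, `|(winsorized eps v i - mu) / b| <= t) /\
  #|[set i | (winsorized eps v i - mu) / b !=
             winsorize (- t) t ((u i - mu) / b)]%SET|%:R <= 3 * eps * n%:R.
Proof.
move=> n0 e12 b0 hD hO; have bn0 : b != 0 by rewrite gt_eqF.
have absb (x : R) : `|x / b| = `|x| / b.
  by rewrite normrM (ger0_norm (x := b^-1))// invr_ge0 ltW.
have hO' : #|[set i | (b * t < `|u i - mu|)%R]%SET|%:R < (eps - eta) * n%:R.
  rewrite (_ : [set i | _]%SET = [set i | (t < `|(u i - mu) / b|)%R]%SET)//.
  by apply/setP => i; rewrite !inE absb ltr_pdivlMr// mulrC.
have [wt wz] := winsorized_compare n0 e12 hD hO'; split.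
  by move=> i; rewrite absb ler_pdivrMr// mulrC.
rewrite (_ : [set i | _]%SET = [set i | winsorized eps v i - mu !=
    winsorize (- (b * t)) (b * t) (u i - mu)]%SET)//.
apply/setP => i; rewrite !inE -[in RHS](divfK bn0 (u i - mu)) (mulrC _ b).
rewrite winsorize_mull// -[in RHS](divfK bn0 (winsorized eps v i - mu)) (mulrC _ b).
by rewrite (inj_eq (mulfI bn0)).
Qed.

Lemma log_ratio_gt0 d n : (1 < n)%N -> (0 < d)%N -> 0 < log_ratio d n :> R.
Proof.
move=> n1 d0; have n0 := ltnW n1.
rewrite divr_gt0 ?ltr0n// ln_gt0// ltr1n.
by rewrite (leq_trans n1)// leq_pmull// expn_gt0 d0.
Qed.

(** A failure probability small enough for a union bound over d^2 pairs of coordinates to leave a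
    multiple of 1 / n. *)
Lemma expR_log_ratio d n : (0 < n)%N -> (0 < d)%N ->
  expR (- (n%:R * log_ratio d n)) = (d ^ 2 * n)%:R^-1 :> R.
Proof.
move=> n0 d0; rewrite mulrC divfK ?pnatr_eq0 -?lt0n// expRN lnK//.
by rewrite posrE ltr0n muln_gt0 n0 expn_gt0 d0.
Qed.

Lemma log_ratio_le d n : (0 < n)%N -> (0 < d)%N ->
  log_ratio d n <= 2 * (ln (d * n)%:R / n%:R) :> R.
Proof.
move=> n0 d0; rewrite mulrA ler_pM2r ?invr_gt0 ?ltr0n//.
have dn0 : (0 < d * n)%N by rewrite muln_gt0 d0.
rewrite mulr_natl -lnXn ?ltr0n// -natrX ler_ln ?posrE ?ltr0n ?muln_gt0 ?expn_gt0 ?d0 ?n0//.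
by rewrite ler_nat expnMn leq_pmul2l ?expn_gt0 ?d0// -mulnn leq_pmulr.
Qed.

(* Makes the exponential moment of the number of exceedances of
   [trunc_level m (trunc_const l1 l2) eps] small enough for the Chernoff bound
   with parameter [2 / l2]. *)
Definition trunc_const (l1 l2 : R) : R :=
  (1 - l1^-1) * (2 / l2) / (2 * (expR (2 / l2) - 1)).

Lemma trunc_const_itv (l1 l2 : R) : 1 < l1 -> 0 < l2 ->
  0 < trunc_const l1 l2 <= 1.
Proof.
move=> l11 l20; have l10 : 0 < l1 by lra.
have lam0 : 0 < 2 / l2 by rewrite divr_gt0.
have e := expR_ge1Dx (2 / l2).
have k1 : l1^-1 < 1 by rewrite invf_lt1.
have k0 : 0 < l1^-1 by rewrite invr_gt0.
rewrite /trunc_const; apply/andP; split.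
  by rewrite divr_gt0// ?mulr_gt0//; lra.
by rewrite ler_pdivrMr; nra.
Qed.

(** The budget is lambda ((l1 - 1) eta + l2 L) with lambda = 2 / l2. By the choice of [c] the first
    summand takes at most half of it, and L = (lambda / 2) l2 L at most the other half. *)
Lemma trunc_const_count (l1 l2 eta L : R) (c := trunc_const l1 l2) :
  1 < l1 -> 0 < l2 -> 0 <= eta -> 0 < L ->
  (expR (2 / l2) - 1) * (c * (l1 * eta + l2 * L)) + L <=
  (2 / l2) * (l1 * eta + l2 * L - eta).
Proof.
move=> l11 l20 eta0 L0; have l10 : 0 < l1 by lra.
have lam0 : 0 < 2 / l2 by rewrite divr_gt0.
have e := expR_ge1Dx (2 / l2).
have en0 : expR (2 / l2) - 1 != 0 by rewrite gt_eqF//; lra.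
have -> : (expR (2 / l2) - 1) * (c * (l1 * eta + l2 * L)) =
    (2 / l2) / 2 * ((1 - l1^-1) * (l1 * eta + l2 * L)).
  by rewrite /c /trunc_const; field; rewrite en0 !gt_eqF.
have -> : (1 - l1^-1) * (l1 * eta + l2 * L) =
    (l1 - 1) * eta + (1 - l1^-1) * (l2 * L) by field; rewrite gt_eqF.
have k0 : 0 < l1^-1 by rewrite invr_gt0.
have LE : L = (2 / l2) / 2 * (l2 * L) by field; rewrite gt_eqF.
have l2L : 0 < l2 * L by rewrite mulr_gt0.
have h : (1 - l1^-1) * (l2 * L) <= l2 * L by rewrite ler_piMl ?ltW//; lra.
have eta1 : 0 <= (l1 - 1) * eta by rewrite mulr_ge0//; lra.
have hh : 2^-1 * ((l1 - 1) * eta + (1 - l1^-1) * (l2 * L) + l2 * L) <=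
    l1 * eta + l2 * L - eta by lra.
apply: le_trans (ler_wpM2l (ltW lam0) hh).
rewrite [X in _ + X <= _]LE; lra.
Qed.

(** [Q <= K] linearizes the square. The coefficients 12 = 4 * 3 and 6 = 2 * 3 stem from
    [k = 3 * eps] in the covariance perturbation, with x = eps t^2 and y = eps t. *)
Lemma quadratic_rate_le (c Q K x y : R) : 0 < c -> 0 <= Q -> Q <= K ->
  x <= c^-1 * Q -> 0 <= y -> y <= c^-1 * Q ->
  5 * Q + 12 * x + (5 * Q + 6 * y) ^+ 2 <=
  (5 + 12 / c + (5 + 6 / c) ^+ 2 * K) * Q.
Proof.
move=> c0 Q0 QK xQ y0 yQ; have cV0 : 0 < c^-1 by rewrite invr_gt0.
have A0 : 0 <= 5 + 6 / c by lra.
have s1 : 5 * Q + 12 * x <= (5 + 12 / c) * Q by lra.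
have s2 : 5 * Q + 6 * y <= (5 + 6 / c) * Q by lra.
rewrite [leRHS]mulrDl lerD// -mulrA (le_trans (y := ((5 + 6 / c) * Q) ^+ 2))//.
  by rewrite ler_pXn2r ?nnegrE ?mulr_ge0// addr_ge0 ?mulr_ge0.
by rewrite exprMn ler_wpM2l ?sqr_ge0// expr2 ler_wpM2r.
Qed.

(** The constant is fixed before the sample size, the dimension and the law. The range of [eps] is
    returned as well because the measurability of the estimator relies on it. *)
Lemma one_sample_bound (m b l1 l2 : R) :
  2 < m -> 0 < b -> 1 < l1 -> 0 < l2 ->
  exists2 C, 0 <= C & forall (b1 : R) (n d : nat) (eta : R)
    (dT : measure_display) (T : measurableType dT) (P : probability T R)
    (mu : 'I_d -> R) (Sigma : 'M[R]_d) (V V' : 'I_n -> {RV P >-> d.-tuple R}),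
  (3 < n)%N -> (2 <= d)%N -> 0 <= eta < 1 / 2 ->
  contamination_model m b1 b eta mu Sigma V V' ->
  let eps := eps_trim l1 l2 eta d n in
  sample_size_term eps d n < 1 ->
  0 < eps < 1 / 2 /\
  whp P (24 / n%:R) (fun w => forall j k,
    `|winsor_cov eps (fun i => V' i w) j k - Sigma j k| <= C * rate m eta d n).
Proof.
move=> m2 b0 l11 l20; have l10 : 0 < l1 by lra.
have m0 : 0 < m by lra.
set c := trunc_const l1 l2; have c01 : 0 < c <= 1 by exact: trunc_const_itv.
have [c0 c1] := andP c01.
have [K K0 KQ] := dev_rate_le m2 l10 l20 c01.
pose A1 := 5 + 12 / c; pose A2 := 5 + 6 / c.
have cV0 : 0 < c^-1 by rewrite invr_gt0.
have A10 : 0 < A1 by rewrite /A1; lra.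
have A20 : 0 < A2 by rewrite /A2; lra.
have AK0 : 0 <= A1 + A2 ^+ 2 * K.
  by rewrite addr_ge0 ?(ltW A10)// mulr_ge0 ?sqr_ge0 ?(ltW K0).
exists (b ^+ 2 * ((A1 + A2 ^+ 2 * K) * K)).
  by rewrite mulr_ge0 ?sqr_ge0// mulr_ge0// ltW.
move=> b1 n d eta dT T P mu Sigma V V' n3 d2 /andP[eta0 eta2] cm eps ss.
have n0 : (0 < n)%N by exact: leq_trans n3.
have n1 : (1 < n)%N by exact: leq_trans n3.
have d0 : (0 < d)%N by exact: leq_trans d2.
have nR : 0 < n%:R :> R by rewrite ltr0n.
pose L : R := log_ratio d n.
have L0 : 0 < L by exact: log_ratio_gt0.
have eps0 : 0 < eps.
  rewrite /eps /eps_trim -/L; have := mulr_gt0 l20 L0.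
  by have := mulr_ge0 (ltW l10) eta0; lra.
have [eps2 L1] : eps < 1 / 2 /\ L < 1.
  move: ss; rewrite /sample_size_term -/L.
  have := sqrtr_ge0 (L ^+ 2 + 4 * L * eps); split; lra.
have e12 : 0 < eps < 1 / 2 by rewrite eps0.
split=> //; set t := trunc_level m c eps.
have ce0 : 0 < c * eps by rewrite mulr_gt0.
have t1 : 1 <= t by apply: trunc_level_ge1 => //; rewrite ce0; nra.
have t0 : 0 < t by lra.
set Q := dev_rate m t L.
have eta01 : 0 <= eta <= 1 by rewrite eta0; lra.
have L01 : 0 < L <= 1 by rewrite L0 ltW.
have [QK Qrate] : Q <= K /\ Q <= K * rate m eta d n.
  exact: (KQ eta L _ eta01 L01 (log_ratio_le n0 d0)).
have indV : mutually_independent V by case: (cm_iid cm).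
have mst j : measurable_fun setT (standardize b mu j).
  exact: measurable_standardize.
have mom i j := standardize_moment m0 b0 cm i j.
set e := expR (- (n%:R * L)).
have count j : whp P e (fun w =>
    #|[set i | t < `|standardize b mu j (V i w)|]%SET|%:R <
    (eps - eta) * n%:R).
  have lam0 : 0 < 2 / l2 by rewrite divr_gt0.
  apply: whp_le (exceedance_concentration (t := t) L m0 t0 lam0 indV (mst j) _) => //.
  move=> w; rewrite trunc_level_powRN//.
  have := trunc_const_count l11 l20 eta0 L0; rewrite -/c -/eps => h.
  move/lt_le_trans => /(_ _ (ler_wpM2l (ltW nR) h)).
  by rewrite mulrCA ltr_pM2l// mulrC.
(* Since t >= 1, clamping fixes the constant 1, so the average of one clamped coordinate is an
   average of products. *)
have w1 : winsorize (- t) t 1 = 1 by rewrite winsorize_id ?normr1.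
have mean j : whp P (2 * e) (fun w => `|n%:R^-1 * (\sum_(i < n)
    winsorize (- t) t (standardize b mu j (V i w)))| <= 5 * Q).
  apply: whp_le (@winsorize_prod_concentration _ _ _ _ _ P n V m t L 0
    (standardize b mu j) (cst 1) n0 m2 t1 L0 indV (mst j) _ _ _ _) => //.
  - move=> w; rewrite subr0; under eq_bigr do rewrite /cst w1 mulr1.
    by [].
  - move=> i; under eq_integral do rewrite /= normr1 powR1.
    by have := expectation_cst P 1; rewrite unlock => ->.
  - move=> i; exact: (standardize_mean cm).
have pair j k : whp P (2 * e) (fun w => `|n%:R^-1 * (\sum_(i < n)
    winsorize (- t) t (standardize b mu j (V i w)) *
    winsorize (- t) t (standardize b mu k (V i w))) -
    Sigma j k / b ^+ 2| <= 5 * Q).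
  apply: winsorize_prod_concentration => // i.
  exact: (standardize_prod m0 b0 cm).
(* Repeating the one-coordinate events for each pair allows a single union bound: d^2 pairs, each
   failing with probability at most (1 + 1 + 2 + 2 + 2) / (d^2 n), give 8 / n. Contamination costs
   probability 0. *)
have all_good := whp_and (whp_ae (cm_contamination cm))
  (whp_all (fun jk : 'I_d * 'I_d => whp_and (whp_and (count jk.1) (count jk.2))
    (whp_and (whp_and (mean jk.1) (mean jk.2)) (pair jk.1 jk.2)))).
apply: whp_le all_good => [|w [cont good] j k].
  rewrite card_prod card_ord add0r /e expR_log_ratio//.
  have dR : 0 < d%:R :> R by rewrite ltr0n.
  rewrite (natrM _ d d) (natrM _ (d ^ 2)) natrX.
  have -> : d%:R * d%:R * ((d%:R ^+ 2 * n%:R)^-1 + (d%:R ^+ 2 * n%:R)^-1 +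
      (2 * (d%:R ^+ 2 * n%:R)^-1 + 2 * (d%:R ^+ 2 * n%:R)^-1 +
       2 * (d%:R ^+ 2 * n%:R)^-1)) = 8 / n%:R :> R.
    move: nR dR; move: (n%:R : R) (d%:R : R) => nu de nu0 de0.
    by field; rewrite !gt_eqF.
  by rewrite ler_pM2r ?invr_gt0//; lra.
have {good} /= [[cj ck] [[mj mk] pjk]] := good (j, k).
have cont' l : #|[set i | tnth (V' i w) l != tnth (V i w) l]%SET|%:R <= eta * n%:R.
  apply: le_trans cont; rewrite ler_nat subset_leq_card//.
  by apply/fintype.subsetP => i; rewrite !inE; apply: contra => /eqP ->.
have [wj wzj] := winsorized_standardize n0 e12 b0 (cont' j) cj.
have [wk wzk] := winsorized_standardize n0 e12 b0 (cont' k) ck.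
pose W l i := winsorized eps (fun i => tnth (V' i w) l) i.
pose ws l i := (W l i - mu l) / b.
have WE l i : W l i = mu l + b * ws l i.
  by rewrite /ws mulrC divfK ?gt_eqF// subrKC.
have := @covariance_affine R n b (mu j) (mu k) (W j) (W k) (ws j) (ws k) n0 (WE j) (WE k).
move=> /= covE; rewrite (_ : winsor_cov eps _ j k = b ^+ 2 *
  (n%:R^-1 * (\sum_(i < n) ws j i * ws k i) -
  n%:R^-1 * (\sum_(i < n) ws j i) * (n%:R^-1 * (\sum_(i < n) ws k i)))); last first.
  by rewrite mxE; exact: covE.
have zt l i : `|winsorize (- t) t (standardize b mu l (V i w))| <= t.
  by rewrite norm_winsorize_le// ltW.
have k0 : 0 <= 3 * eps by rewrite mulr_ge0// ltW.
have := sample_covariance_perturbation n0 (ltW t0) k0 wj wk (zt j) (zt k) wzj wzk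
  pjk mj mk.
rewrite -[X in `|X - _|]/(n%:R^-1 * (\sum_(i < n) ws j i * ws k i) -
  n%:R^-1 * (\sum_(i < n) ws j i) * (n%:R^-1 * (\sum_(i < n) ws k i))).
set X := n%:R^-1 * _ - _ => hD; clearbody X.
have -> : b ^+ 2 * X - Sigma j k = b ^+ 2 * (X - Sigma j k / b ^+ 2).
  by rewrite mulrBr [b ^+ 2 * (Sigma j k / _)]mulrC divfK ?expf_neq0 ?gt_eqF.
rewrite normrM (ger0_norm (sqr_ge0 b)) -[leRHS]mulrA ler_wpM2l ?sqr_ge0//.
apply: (le_trans hD).
have p0 : 0 <= t `^ (2 - m) by exact: powR_ge0.
have tQ : t `^ (2 - m) <= Q.
  have := mulr_ge0 (ltW L0) (sqr_ge0 t); have := sqrtr_ge0 L.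
  rewrite /Q /dev_rate; lra.
have Q0 : 0 <= Q by exact: le_trans tQ.
have et2 : eps * t ^+ 2 <= c^-1 * Q.
  by rewrite eps_trunc_level_sqr// ler_wpM2l// ltW.
have et : eps * t <= c^-1 * Q.
  by apply: le_trans et2; rewrite ler_wpM2l ?(ltW eps0)// expr2 ler_peMl// ltW.
have et0 : 0 <= eps * t by rewrite mulr_ge0// ltW.
have := quadratic_rate_le c0 Q0 QK et2 et0 et; rewrite -/A1 -/A2.
have -> : 5 * Q + 12 * (eps * t ^+ 2) + (5 * Q + 6 * (eps * t)) ^+ 2 =
  5 * Q + 4 * (3 * eps) * t ^+ 2 + (5 * Q + 2 * (3 * eps) * t) ^+ 2 by ring.
by move/le_trans; apply; rewrite -[leRHS]mulrA ler_wpM2l.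
Qed.

End one_sample.

(** * Combination of the two samples *)

Theorem proposition3p1 (R : realType)
    (mX mY b2X b2Y l1X l1Y l2X l2Y : R)
    (hmX : 2 < mX) (hmY : 2 < mY) (hb2X : 0 < b2X) (hb2Y : 0 < b2Y)
    (hl1X : 1 < l1X) (hl1Y : 1 < l1Y) (hl2X : 0 < l2X) (hl2Y : 0 < l2Y) :
  exists C : R,
  forall (b1X b1Y : R), 0 < b1X -> 0 < b1Y ->
  forall (nX nY d : nat), (3 < nX)%N -> (3 < nY)%N -> (2 <= d)%N ->
  forall (etaX etaY : R), 0 <= etaX < 1 / 2 -> 0 <= etaY < 1 / 2 ->
  forall (dT : measure_display) (T : measurableType dT) (P : probability T R)
    (muX muY : 'I_d -> R) (SigmaX SigmaY : 'M[R]_d)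
    (X X' : 'I_nX -> {RV P >-> d.-tuple R})
    (Y Y' : 'I_nY -> {RV P >-> d.-tuple R}),
  contamination_model mX b1X b2X etaX muX SigmaX X X' ->
  contamination_model mY b1Y b2Y etaY muY SigmaY Y Y' ->
  let epsX := eps_trim l1X l2X etaX d nX in
  let epsY := eps_trim l1Y l2Y etaY d nY in
  Num.max (sample_size_term epsX d nX) (sample_size_term epsY d nY) < 1 ->
  let wX : R := weight nX nY in
  let wY : R := weight nY nX in
  let SigmaD : 'M[R]_d := wY ^+ 2 *: SigmaX + wX ^+ 2 *: SigmaY in
  let estX w := winsor_cov epsX (fun i => X' i w) in
  let estY w := winsor_cov epsY (fun i => Y' i w) in
  let rateX := rate mX etaX d nX in
  let rateY := rate mY etaY d nY in
  let bound : R := 24 * ((nY + nX)%:R / (nX * nY)%:R) in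
  (P [set w | (max_entry (wY ^+ 2 *: estX w + wX ^+ 2 *: estY w - SigmaD) >
              C * (wY ^+ 2 * rateX + wX ^+ 2 * rateY))%R] <= bound%:E)%E
  /\
  (SigmaX = SigmaY ->
   (P [set w | (max_entry (wX ^+ 2 *: estX w + wY ^+ 2 *: estY w - SigmaD) >
               C * (wX ^+ 2 * rateX + wY ^+ 2 * rateY))%R] <= bound%:E)%E).
Proof.
have [CX CX0 HX] := one_sample_bound hmX hb2X hl1X hl2X.
have [CY CY0 HY] := one_sample_bound hmY hb2Y hl1Y hl2Y.
exists (Num.max CX CY) => b1X b1Y _ _ nX nY d nX3 nY3 d2 etaX etaY etaX01 etaY01.
move=> dT T P muX muY SigmaX SigmaY X X' Y Y' cmX cmY epsX epsY.
rewrite gt_max => /andP[ssX ssY] wX wY SigmaD estX estY rateX rateY bound.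
have [eX goodX] := HX _ _ _ _ _ _ _ _ _ _ _ nX3 d2 etaX01 cmX ssX.
have [eY goodY] := HY _ _ _ _ _ _ _ _ _ _ _ nY3 d2 etaY01 cmY ssY.
have nX0 : 0 < nX%:R :> R by rewrite ltr0n (leq_trans _ nX3).
have nY0 : 0 < nY%:R :> R by rewrite ltr0n (leq_trans _ nY3).
have boundE : 24 / nX%:R + 24 / nY%:R = bound.
  rewrite /bound natrD natrM; move: nX0 nY0.
  move: (nX%:R : R) (nY%:R : R) => x y x0 y0; by field; rewrite !gt_eqF.
have nXY0 : 0 < (nX + nY)%:R :> R by rewrite natrD addr_gt0.
have wX2 : wX ^+ 2 = nX%:R / (nX + nY)%:R.
  by rewrite sqr_sqrtr// divr_ge0 ?ler0n.
have wY2 : wY ^+ 2 = nY%:R / (nX + nY)%:R.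
  by rewrite sqr_sqrtr ?divr_ge0 ?ler0n// addnC.
have w1 : wX ^+ 2 + wY ^+ 2 = 1.
  by rewrite wX2 wY2 -mulrDl -natrD divff// gt_eqF.
have rX0 : 0 <= rateX by rewrite addr_ge0 ?powR_ge0.
have rY0 : 0 <= rateY by rewrite addr_ge0 ?powR_ge0.
(* Both estimators at once: they differ in the weights only, and the target must be the same
   combination of the true matrices. *)
have combine (a b : R) (Sig : 'M[R]_d) : 0 <= a -> 0 <= b ->
    a *: SigmaX + b *: SigmaY = Sig ->
    (P [set w | (max_entry (a *: estX w + b *: estY w - Sig) >
      Num.max CX CY * (a * rateX + b * rateY))%R] <= bound%:E)%E.
  move=> a0 b0 SigE.
  have entry (A B S : 'M[R]_d) j k :
      (a *: A + b *: B - S) j k = a * A j k + b * B j k - S j k by rewrite !mxE.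
  apply: whp_not.
    rewrite (_ : [set w | _] = ~` [set w |
        max_entry (a *: estX w + b *: estY w - Sig) <=
        Num.max CX CY * (a * rateX + b * rateY)]); last first.
      by apply/seteqP; split => w /=; rewrite ltNge => /negP.
    apply: measurableC; rewrite -[X in measurable X]setTI.
    apply: measurable_fun_le => //.
    apply: measurable_max_entry => j k; under eq_fun do rewrite entry.
    by apply: measurable_funB => //; apply: measurable_funD;
      apply: measurable_funM => //; exact: measurable_winsor_cov.
  (* A union bound is indifferent to dependence between the two samples. *)
  rewrite -boundE; apply: whp_le (whp_and goodX goodY) => // w [gX gY] /=.
  apply/negP; rewrite -leNgt.
  have C0 : 0 <= Num.max CX CY by rewrite le_max CX0.
  (* The maxima in [max_entry] start from 0, so the bound has to be nonnegative. *)
  have R0 : 0 <= Num.max CX CY * (a * rateX + b * rateY).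
    by rewrite mulr_ge0// addr_ge0// mulr_ge0.
  apply: bigmax_le => // j _; apply: bigmax_le => // k _.
  rewrite entry; have -> : a * estX w j k + b * estY w j k - Sig j k =
      a * (estX w j k - SigmaX j k) + b * (estY w j k - SigmaY j k).
    have -> : Sig j k = a * SigmaX j k + b * SigmaY j k by rewrite -SigE !mxE.
    by ring.
  rewrite (le_trans (ler_normD _ _))// !normrM (ger0_norm a0) (ger0_norm b0).
  rewrite mulrDr lerD// mulrCA ler_wpM2l//.
    by apply: le_trans (gX j k) _; rewrite ler_wpM2r// le_max lexx.
  by apply: le_trans (gY j k) _; rewrite ler_wpM2r// le_max lexx orbT.
split; first by apply: combine; rewrite ?sqr_ge0.
(* With equal covariance matrices, exchanging the weights leaves the target unchanged. *)
move=> SXY; apply: combine; rewrite ?sqr_ge0//.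
by rewrite /SigmaD SXY -!scalerDl addrC.
Qed.
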